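(* If $(A_n)_{n=0}^\infty$ is an Appell sequence with constants $c_n$ defined by $\log f_A(t)=\sum_{k\ge1}c_k\frac{t^k}{k!}$, then for all partitions $\lambda$, \begin{align*} (\lvert \lambda \rvert +1) (x+c_1) F_\lambda A_\lambda &= \sum_{\gamma \gtrdot \lambda} F_\gamma A_\gamma,\\ k c_k \binom{\lvert \lambda \rvert +k}{k} F_\lambda A_\lambda &= \sum_{\gamma:\ \gamma/\lambda \text{ is a rim hook of size } k} (-1)^{\operatorname{ht}(\gamma/\lambda)} F_\gamma A_\gamma \qquad (k \geq 2), \end{align*} where in the first sum $\gamma$ ranges over partitions covering $\lambda$ in Young's lattice (obtained by adding one cell).
   Context: An Appell sequence is a sequence of polynomials $(A_n)_{n\ge0}$ with $A_0=1$ and $A_n'=nA_{n-1}$ for $n\ge1$; it satisfies $\sum_k A_k(x)t^k/k!=e^{xt}f_A(t)$ with $f_A(0)=1$. For a partition $\lambda$ of length $r$, let $(n_1,\dots,n_r)=(\lambda_r,\lambda_{r-1}+1,\dots,\lambda_1+r-1)$ and $A_\lambda=\operatorname{Wr}[A_{n_1},\dots,A_{n_r}]/\Delta(n_1,\dots,n_r)$, where $\operatorname{Wr}$ is the Wronskian and $\Delta$ the Vandermonde determinant $\prod_{i<j}(x_j-x_i)$. $F_\lambda$ is the number of standard Young tableaux of shape $\lambda$. A rim hook of size $k$ is a skew diagram $\gamma/\lambda$ with $|\gamma|-|\lambda|=k$ that is connected and contains no $2\times2$ square; its height $\operatorname{ht}(\gamma/\lambda)$ is one less than the number of rows it occupies.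 *)

(* Defs.v *)
From HB Require Import structures.
From mathcomp Require Import all_boot all_order all_algebra.
Set Implicit Arguments.
Unset Strict Implicit.
Unset Printing Implicit Defensive.
Import Order.TTheory GRing.Theory Num.Theory.
Local Open Scope ring_scope.

Definition is_partition (l : seq nat) : bool :=
  sorted geq l && all (fun x => 0 < x)%N l.

Fixpoint allseqs (m len : nat) : seq (seq nat) :=
  match len with
  | 0 => [:: [::]]
  | len'.+1 => [::] :: [seq x :: s | x <- iota 1 m, s <- allseqs m len']
  end.

Definition partitions_of (n : nat) : seq (seq nat) :=
  undup [seq s <- allseqs n n | is_partition s && (sumn s == n)].

(* cell (i, j) = row i, column j (0-indexed) *)
Definition in_diagram (l : seq nat) (c : nat * nat) : bool := (c.2 < nth 0 l c.1)%N.

Definition subpart (l g : seq nat) : bool :=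
  all (fun i => nth 0 l i <= nth 0 g i)%N (iota 0 (size l)).

Definition covers (g l : seq nat) : bool :=
  subpart l g && (sumn g == (sumn l).+1)%N.

(* A standard Young tableau of shape l (with n = |l| cells) is encoded by the
   map T sending k (the entry k+1) to the cell containing it; T must be a
   bijection onto the cells of l, and entries increase along rows and down
   columns. *)
Definition is_SYT (l : seq nat) (n : nat) (T : {ffun 'I_n -> 'I_n * 'I_n}) : bool :=
  [&& injectiveb T,
      [forall a, in_diagram l (nat_of_ord (T a).1, nat_of_ord (T a).2)] &
      [forall a, forall b,
         ((T a).1 <= (T b).1)%N ==> ((T a).2 <= (T b).2)%N ==> (a <= b)%N]].

Definition nSYT (l : seq nat) : nat :=
  #|[set T : {ffun 'I_(sumn l) -> 'I_(sumn l) * 'I_(sumn l)} | is_SYT l T]|.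

Definition in_skew (l g : seq nat) (c : nat * nat) : bool :=
  in_diagram g c && ~~ in_diagram l c.

Definition skew_adj (l g : seq nat) (N : nat) : rel ('I_N * 'I_N) :=
  fun c d =>
    [&& in_skew l g (nat_of_ord c.1, nat_of_ord c.2),
        in_skew l g (nat_of_ord d.1, nat_of_ord d.2) &
        (((c.1 == d.1 :> nat) && ((c.2.+1 == d.2 :> nat) || (d.2.+1 == c.2 :> nat))) ||
         ((c.2 == d.2 :> nat) && ((c.1.+1 == d.1 :> nat) || (d.1.+1 == c.1 :> nat))))].

(* the skew diagram g/l is connected (edge-adjacency of cells); all cells
   have coordinates < sumn g *)
Definition skew_connected (l g : seq nat) : bool :=
  let N := sumn g in
  [forall c : 'I_N * 'I_N, forall d : 'I_N * 'I_N,
     in_skew l g (nat_of_ord c.1, nat_of_ord c.2) ==>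
     in_skew l g (nat_of_ord d.1, nat_of_ord d.2) ==>
     connect (@skew_adj l g N) c d].

Definition skew_no_square (l g : seq nat) : bool :=
  let N := sumn g in
  ~~ [exists i : 'I_N, exists j : 'I_N,
        [&& in_skew l g (nat_of_ord i, nat_of_ord j), in_skew l g (i.+1, nat_of_ord j),
            in_skew l g (nat_of_ord i, j.+1) & in_skew l g (i.+1, j.+1)]].

Definition rim_hook (k : nat) (l g : seq nat) : bool :=
  [&& subpart l g, (sumn g == sumn l + k)%N, skew_connected l g & skew_no_square l g].

Definition rim_height (l g : seq nat) : nat :=
  (count (fun i => nth 0 l i < nth 0 g i)%N (iota 0 (size g))).-1.

Definition is_Appell (R : fieldType) (A : nat -> {poly R}) : Prop :=
  A 0%N = 1 /\ forall n, (A n.+1)^`() = (n.+1)%:R *: A n.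

(* truncation to degree k of f_A(t) - 1 = sum_{j>=1} A_j(0) t^j / j! *)
Definition fA_trunc (R : fieldType) (A : nat -> {poly R}) (k : nat) : {poly R} :=
  \sum_(1 <= j < k.+1) ((A j).[0] / (j`!)%:R) *: 'X^j.

(* c_k = k! [t^k] log f_A(t), with log(1+u) = sum_{m>=1} (-1)^(m+1) u^m / m;
   terms with m > k or of degree > k do not contribute to [t^k]. *)
Definition appell_c (R : fieldType) (A : nat -> {poly R}) (k : nat) : R :=
  (k`!)%:R *
  (\sum_(1 <= m < k.+1) ((-1) ^+ m.+1 / m%:R) *: (fA_trunc A k) ^+ m)`_k.

Definition wr_indices (l : seq nat) : seq nat :=
  [seq (nth 0 l (size l - i.+1) + i)%N | i <- iota 0 (size l)].

Definition wronskian (R : fieldType) (ps : seq {poly R}) : {poly R} :=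
  \det (\matrix_(i < size ps, j < size ps) (nth 0 ps j)^`(i)).

Definition vandermonde (R : fieldType) (xs : seq nat) : R :=
  \prod_(i < size xs) \prod_(j < size xs | (i < j)%N)
     ((nth 0 xs j)%:R - (nth 0 xs i)%:R).

Definition Apart (R : fieldType) (A : nat -> {poly R}) (l : seq nat) : {poly R} :=
  (vandermonde R (wr_indices l))^-1 *: wronskian [seq A n | n <- wr_indices l].

(* Main.v *)
(* With h_n = A_n / n!, the Wronskian of the A_{n_j} is, up to the factor
   prod_j n_j!, the Jacobi-Trudi determinant s_l = det (h_{n_j - i}).
   Frobenius' formula F_l prod_j n_j! = |l|! Delta(n) turns F_l A_l into
   |l|! s_l, and the theorem becomes the Murnaghan-Nakayama rule
   p_k s_l = sum_g (-1)^ht(g/l) s_g, where the p_k are defined from the h_n by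
   Newton's identities; these give p_k = c_k / (k-1)! + [k = 1] x.

   Frobenius' formula follows by induction from removing the largest entry of a
   tableau and sum_j n_j Delta(n - e_j) = (sum_j n_j - binom(r,2)) Delta(n).
   For Murnaghan-Nakayama, pad l with k empty rows.  The sum over j of the
   determinants with n_j replaced by n_j + k is tr (adj M * N) with
   N_ij = h_{n_j + k - i}; reading this trace along rows gives p_k det M.
   Reordering n + k e_j produces the rim hooks and their signs. *)
Require Import Defs.
From HB Require Import structures.
From mathcomp Require Import all_boot all_order all_algebra all_fingroup.
From mathcomp Require Import zify ring.
Import Order.TTheory GRing.Theory Num.Theory.
Set Implicit Arguments.
Unset Strict Implicit.
Local Open Scope ring_scope.

(** * Column replacement and determinants of falling factorials *)

Lemma sum_det_replace_col (S : comNzRingType) (r : nat) (M N : 'M[S]_r) :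
  \sum_j \det (\matrix_(a, b) if b == j then N a b else M a b)
    = \tr (\adj M *m N).
Proof.
(* Expanding along the replaced column [j] meets only cofactors of [M], so the [j]-th determinant is
   the [(j, j)] entry of [\adj M *m N]. *)
apply: eq_bigr => j _; rewrite (expand_det_col _ j) !mxE.
apply: eq_bigr => i _; rewrite !mxE eqxx mulrC; congr (_ * _).
rewrite /cofactor; congr (_ * \det _); apply/matrixP => a b.
by rewrite !mxE eq_sym (negPf (neq_lift _ _)).
Qed.

Lemma horner_ffact (S : comNzRingType) (x i : nat) :
  (\prod_(a < i) ('X - a%:R%:P : {poly S})).[x%:R] = (x ^_ i)%:R.
Proof.
elim: i => [|i IHi]; first by rewrite big_ord0 hornerC ffactn0.
rewrite big_ord_recr /= hornerM IHi ffactnSr natrM hornerXsubC.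
(* For [i > x] the natural subtraction [x - i] truncates, but then [x ^_ i] is already 0. *)
case: (leqP i x) => hi; first by rewrite natrB.
by rewrite ffact_small // !mul0r.
Qed.

(** The falling factorials are monic of degree [i] in [x], so the matrix is a unitriangular matrix
    times the Vandermonde matrix. *)
Lemma det_ffact (S : comNzRingType) (r : nat) (x : nat -> nat) :
  \det (\matrix_(i < r, j < r) ((x j) ^_ i)%:R : 'M[S]_r)
    = \prod_(i < r) \prod_(j < r | (i < j)%N) ((x j)%:R - (x i)%:R).
Proof.
pose P i : {poly S} := \prod_(a < i) ('X - a%:R%:P).
have sP i : size (P i) = i.+1.
  by rewrite size_prod_XsubC /index_enum -enumT size_enum_ord.
pose L : 'M[S]_r := \matrix_(i < r, m < r) (P i)`_m.
have -> : (\matrix_(i < r, j < r) ((x j) ^_ i)%:R : 'M[S]_r)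
    = L *m Vandermonde r (\row_(j < r) (x j)%:R).
  apply/matrixP => i j; rewrite !mxE -horner_ffact -/(P i).
  rewrite (@horner_coef_wide _ r) ?sP //.
  by apply: eq_bigr => m _; rewrite !mxE.
rewrite det_mulmx det_Vandermonde det_trig; last first.
  apply/is_trig_mxP => i m lt_im; rewrite mxE nth_default // sP //.
rewrite big1 ?mul1r => [|i _].
  by apply: eq_bigr => i _; apply: eq_bigr => j _; rewrite !mxE.
rewrite mxE; have : P i \is monic by apply: monic_prod_XsubC.
by rewrite monicE lead_coefE sP => /eqP.
Qed.

(* With falling factorials, [x * ffact (x - 1) i = (x - i) * ffact x i], so the
   matrix of replacement columns is [M * diag x - diag i * M]. *)
Lemma sum_vandermonde_pred (S : comNzRingType) (r : nat) (x : nat -> nat) :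
  \sum_(j < r) (x j)%:R * \det (\matrix_(a < r, b < r)
      ((if b == j then (x b).-1 else x b) ^_ a)%:R : 'M[S]_r)
  = (\sum_(j < r) (x j)%:R - \sum_(j < r) j%:R)
     * \det (\matrix_(i < r, j < r) ((x j) ^_ i)%:R : 'M[S]_r).
Proof.
set M := \matrix_(i, j) _.
pose X : 'M[S]_r := diag_mx (\row_j (x j)%:R).
pose I : 'M[S]_r := diag_mx (\row_(j < r) j%:R).
transitivity (\tr (\adj M *m (M *m X - I *m M))).
  rewrite -sum_det_replace_col mul_mx_diag mul_diag_mx; apply: eq_bigr => j _.
  rewrite !(expand_det_col _ j) mulr_sumr; apply: eq_bigr => i _.
  rewrite mulrA; congr (_ * _).
    rewrite !mxE eqxx -[LHS]natrM.
    have -> : (x j * (x j).-1 ^_ i)%N = x j ^_ i.+1.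
      by case: (x j) => [|y] //; rewrite ?mul0n ?ffact0n ?ffactSS.
    rewrite ffactnSr natrM [i%:R * _]mulrC -mulrBr.
    case: (leqP i (x j)) => h; first by rewrite natrB.
    by rewrite ffact_small // !mul0r.
  rewrite /cofactor; congr (_ * \det _); apply/matrixP => a b.
  by rewrite !mxE eq_sym (negPf (neq_lift _ _)).
rewrite mulmxBr raddfB /= mulmxA mul_adj_mx.
rewrite [\tr (_ *m (I *m M))]mxtrace_mulC.
rewrite -mulmxA mul_mx_adj mul_scalar_mx mul_mx_scalar !mxtraceZ.
rewrite !mxtrace_diag mulrBl; congr (_ - _); rewrite mulrC; congr (_ * _);
  by apply: eq_bigr => j _; rewrite mxE.
Qed.

(** * Multiplying a Jacobi-Trudi determinant by a power sum *)

Lemma series_inverse_trunc (S : comNzRingType) (H : {poly S}) (B : nat) :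
  H`_0 = 1 -> exists G : {poly S}, forall n, (n < B)%N -> (H * G)`_n = (n == 0%N)%:R.
Proof.
move=> H0; elim: B => [|B [G HG]]; first by exists 0.
(* A multiple of ['X^B] corrects coefficient [B] and leaves the lower ones alone, because [H] has
   constant term 1. *)
exists (G + ((B == 0%N)%:R - (H * G)`_B) *: 'X^B) => n; rewrite ltnS => le_nB.
rewrite mulrDr coefD -scalerAr coefZ coefMXn.
have [lt_nB|] := ltnP n B; first by rewrite mulr0 addr0 HG.
move=> le_Bn; have -> : n = B by apply/eqP; rewrite eqn_leq le_nB.
by rewrite subnn H0 mulr1 addrC subrK.
Qed.

Lemma coef_mul_one_trunc (S : comNzRingType) (Q U : {poly S}) (B n : nat) :
  (forall m, (m < B)%N -> U`_m = (m == 0%N)%:R) -> (n < B)%N ->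
  (Q * U)`_n = Q`_n.
Proof.
move=> HU lt_nB; rewrite coefM big_ord_recr /= subnn HU ?mulr1; last first.
  exact: leq_ltn_trans lt_nB.
rewrite big1 ?add0r // => i _.
rewrite HU ?(leq_ltn_trans (leq_subr _ _) lt_nB) //.
by rewrite subn_eq0 leqNgt ltn_ord mulr0.
Qed.

(** This is [h_(n - i)] with [h] extended by 0 to negative indices; bare natural subtraction would
    give [h 0] there. *)
Definition toep (S : nzRingType) (h : nat -> S) (n i : nat) : S :=
  if (i <= n)%N then h (n - i)%N else 0.

Definition jt_det (S : comNzRingType) (h : nat -> S) (r : nat) (n : nat -> nat) : S :=
  \det (\matrix_(i < r, j < r) toep h (n j) i).

Section PowerSumTrace.

Variables (S : comNzRingType) (h p : nat -> S) (k r : nat) (n : nat -> nat).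
Hypothesis h0 : h 0%N = 1.
Hypothesis newton : forall m, (m <= k)%N ->
  m%:R * h m = \sum_(i < m.+1) p i * h (m - i)%N.
Hypothesis k_gt0 : (0 < k)%N.
Hypothesis le_kr : (k <= r)%N.
Hypothesis n_small : forall j, (j < k)%N -> n j = j.

Let M : 'M[S]_r := \matrix_(i, j) toep h (n j) i.
(** The determinant of [M] with row [i] replaced by the row of index [a], where [a] may lie beyond
    the [r] rows of [M]. *)
Let W (a : nat) (i : 'I_r) : S := \sum_(j < r) toep h (n j) a * (\adj M) j i.

Let W_small (a i : 'I_r) : W a i = \det M *+ (a == i).
Proof.
transitivity ((M *m \adj M) a i).
  by rewrite mxE; apply: eq_bigr => j _; rewrite [M a j]mxE.
by rewrite mul_mx_adj mxE.
Qed.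

(* [u = W a] solves [u *m M = \det M *: v] with [v] vanishing on the first [k]
   columns, where [M] is unitriangular; hence [u] vanishes there too. *)
Let W_big (a : nat) (i : 'I_r) : (r <= a)%N -> (i < k)%N -> W a i = 0.
Proof.
move=> le_ra; have [m] := ubnP (nat_of_ord i).
elim: m i => // m IHm i; rewrite ltnS => le_im lt_ik.
have: \sum_(b < r) W a b * M b i = 0.
  transitivity (\sum_(j < r) toep h (n j) a * (\adj M *m M) j i).
    under eq_bigr do rewrite mulr_suml.
    rewrite exchange_big /=; apply: eq_bigr => j _.
    by rewrite mxE mulr_sumr; apply: eq_bigr => b _; rewrite mulrA.
  rewrite mul_adj_mx (bigD1 i) //= big1 ?addr0 => [|j ne_ji].
    rewrite /toep n_small // leqNgt (leq_trans lt_ik) ?mul0r //.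
    exact: leq_trans le_ra.
  by rewrite mxE (negPf ne_ji) mulr0.
rewrite (bigD1 i) //= big1 ?addr0 => [|b ne_bi].
  by rewrite mxE /toep n_small // leqnn subnn h0 mulr1.
have [lt_bi|le_ib] := ltnP b i.
  by rewrite IHm ?mul0r //; lia.
rewrite mxE /toep n_small // leqNgt ltn_neqAle le_ib andbT.
by rewrite eq_sym in ne_bi; rewrite -val_eqE in ne_bi; rewrite ne_bi mulr0.
Qed.

(** Each row of the shifted matrix [N] is a combination of the rows of [M], continued past index
    [r], with coefficients independent of [n]. So the trace is [\det M] times a quantity depending
    on [h] alone, which Newton's identities identify as [p k]. *)
Lemma power_sum_mul_jt_det :
  p k * jt_det h r n =
  \sum_(j < r) jt_det h r (fun i => if i == j :> nat then (n i + k)%N else n i).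
Proof.
(* [B] exceeds [r], [k] and every [n j], so computing modulo ['X^B] loses no coefficient used
   below. *)
pose B := (r + k + \max_(j < r) n j).+1.
have ltnB (j : 'I_r) : (n j < B)%N.
  by have := leq_bigmax (F := fun j : 'I_r => n j) j; rewrite /B ltnS => /leq_trans -> //; rewrite leq_addl.
pose H := \poly_(i < B) h i.
have [|G HG] := @series_inverse_trunc S H B; first by rewrite coef_poly.
(* As series, [c m] is the sum of the [h_(m + b) t^b] divided by that of the [h_b t^b]; its
   coefficients write the shift of [h] by [m] in terms of backward shifts. *)
pose c m := (\poly_(b < B) h (m + b)%N) * G.
have shift m j : (j < B)%N -> \sum_(a < B) (c m)`_a * toep h j a = h (m + j)%N.
  move=> lt_jB; transitivity ((c m * H)`_j); last first.
    rewrite /c -mulrA [G * H]mulrC (coef_mul_one_trunc _ HG) //.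
    by rewrite coef_poly lt_jB.
  rewrite coefM (big_ord_widen B (fun a => (c m)`_a * H`_(j - a))) //.
  rewrite [RHS]big_mkcond /=; apply: eq_bigr => a _; rewrite /toep ltnS.
  case: ifP => // _; last by rewrite mulr0.
  by rewrite coef_poly (leq_ltn_trans (leq_subr _ _)).
pose N : 'M[S]_r := \matrix_(i, j) toep h (n j + k) i.
transitivity (\tr (\adj M *m N)); last first.
  rewrite -sum_det_replace_col; apply: eq_bigr => j _; congr (\det _).
  by apply/matrixP => a b; rewrite !mxE val_eqE; case: ifP.
have le_rB : (r <= B)%N by rewrite /B; lia.
have lt_kB : (k < B)%N by rewrite /B; lia.
(* For [i >= k], row [i] of [N] is row [i - k] of [M] and contributes nothing to the diagonal. For
   [i < k] it expands in the rows of index [a < B]: those with [a < r], [a != i] vanish by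
   [W_small], those with [a >= r] by [W_big]. *)
have diag (i : 'I_r) :
    (N *m \adj M) i i = (if (i < k)%N then (c (k - i)%N)`_i else 0) * \det M.
  case: ltnP => lt_ik; last first.
    have lt_ikr : (i - k < r)%N by rewrite (leq_ltn_trans (leq_subr _ _)).
    transitivity (W (Ordinal lt_ikr) i).
      rewrite mxE; apply: eq_bigr => j _; congr (_ * _).
      rewrite mxE /toep /= leq_subLR addnC; case: ifP => // h1.
      by congr (h _); lia.
    rewrite W_small mul0r.
    by case: eqP => // /(congr1 val) /=; lia.
  transitivity (\sum_(a < B) (c (k - i)%N)`_a * W a i).
    transitivity (\sum_(a < B) \sum_(j < r) (c (k - i)%N)`_a * (toep h (n j) a * \adj M j i));
      last by apply: eq_bigr => a _; rewrite mulr_sumr.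
    rewrite exchange_big /= mxE; apply: eq_bigr => j _.
    under eq_bigr do rewrite mulrA.
    rewrite -mulr_suml shift // mxE /toep; congr (_ * _).
    rewrite ifT; last lia.
    by congr (h _); lia.
  rewrite (bigD1 (widen_ord le_rB i)) //= W_small eqxx big1 ?addr0 // => a ne_ai.
  have [lt_ar|le_ra] := ltnP a r; last by rewrite W_big ?mulr0.
  rewrite (W_small (Ordinal lt_ar)) -val_eqE /=.
  by rewrite -val_eqE /= in ne_ai; rewrite (negPf ne_ai) mulr0.
rewrite mxtrace_mulC /mxtrace (eq_bigr _ (fun i _ => diag i)) -mulr_suml.
congr (_ * _); rewrite -big_mkcond /=.
rewrite -(big_ord_widen r (fun i => (c (k - i)%N)`_i)) //.
pose P := \poly_(m < B) p m.
transitivity ((P * H * G)`_k).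
  by rewrite -mulrA (coef_mul_one_trunc _ HG) // coef_poly lt_kB.
(* The coefficients of [P * H] are [m h_m], so a factor [k - d] goes with [h_(k - d) G_d]; on the
   other side it counts the [i] with [d <= i < k]. *)
transitivity (\sum_(i < k) \sum_(d < k | (d <= i)%N) h (k - d)%N * G`_d); last first.
  apply: eq_bigr => i _; rewrite /c coefMr.
  rewrite (big_ord_widen k (fun d => (\poly_(b < B) h (k - i + b)%N)`_(i - d) * G`_d)) //.
  apply: eq_big => [d|d le_di]; first by rewrite ltnS.
  rewrite coef_poly ifT; last by have := ltn_ord i; lia.
  by congr (h _ * _); have := ltn_ord i; lia.
rewrite (exchange_big_dep xpredT) //= coefMr big_ord_recr /= subnn.
have PH m : (m <= k)%N -> (P * H)`_m = m%:R * h m.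
  move=> le_mk; rewrite newton // coefM; apply: eq_bigr => i _.
  have := ltn_ord i; rewrite !coef_poly => lt_im.
  by rewrite !ifT //; lia.
rewrite PH // mul0r mul0r addr0; apply: eq_bigr => d _.
rewrite PH ?leq_subr // -mulrA mulr_natl.
by rewrite -(big_geq_mkord _ _ xpredT (fun=> h (k - d)%N * G`_d)) sumr_const_nat.
Qed.

End PowerSumTrace.

(** * Newton's identities for an Appell sequence *)

Section AppellNewton.

Variables (R : fieldType) (A : nat -> {poly R}).
Hypothesis charR0 : [pchar R] =i pred0.
Hypothesis HA : is_Appell A.

Let natr_neq0 (n : nat) : (n.+1)%:R != 0 :> R.
Proof. by rewrite (pcharf0P R).1. Qed.

Lemma fact_neq0 (n : nat) : (n`!)%:R != 0 :> R.
Proof. by rewrite (pcharf0P R).1 // -lt0n fact_gt0. Qed.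

Definition appell_h (n : nat) : {poly R} := ((n`!)%:R)^-1 *: A n.

Lemma appell_h0 : appell_h 0 = 1.
Proof. by rewrite /appell_h fact0 invr1 scale1r; case: HA. Qed.

Lemma deriv_appell_h (n : nat) : (appell_h n.+1)^`() = appell_h n.
Proof.
rewrite /appell_h derivZ; case: HA => _ ->.
by rewrite scalerA factS natrM invfM mulrAC mulVf ?mul1r.
Qed.

(** The scalar depends only on [n], so in a Wronskian it comes out of a whole column. *)
Lemma derivn_appell (n i : nat) :
  (A n)^`(i) = (n`!)%:R *: toep appell_h n i.
Proof.
elim: i => [|i IHi].
  by rewrite derivn0 /toep leq0n subn0 /appell_h scalerA mulfV ?fact_neq0 ?scale1r.
rewrite derivnS IHi derivZ; congr (_ *: _); rewrite /toep.
case: ltngtP => [lt_in|lt_ni|->].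
- by rewrite -[RHS]deriv_appell_h -subSn // subSS.
- by rewrite deriv0.
- by rewrite subnn appell_h0 derivC.
Qed.

Lemma poly_eq0_deriv (d : {poly R}) : d^`() = 0 -> d.[0] = 0 -> d = 0.
Proof.
move=> d'0 d0; apply/polyP => -[|i]; first by rewrite coef0 -horner_coef0.
have := coef_deriv d i; rewrite d'0 !coef0 => /esym/eqP.
by rewrite -mulr_natl mulf_eq0 (negPf (natr_neq0 _)) => /eqP.
Qed.

Definition log_trunc (k : nat) : {poly R} :=
  \sum_(1 <= m < k.+1) ((-1) ^+ m.+1 / m%:R) *: (fA_trunc A k) ^+ m.

Lemma coef_fA_trunc (k m : nat) : (m <= k)%N ->
  (1 + fA_trunc A k)`_m = (appell_h m).[0].
Proof.
move=> le_mk; rewrite coefD coef1 /fA_trunc coef_sum.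
case: m le_mk => [|m] le_mk.
  rewrite big_nat big1 ?addr0 => [|i /andP[i_gt0 _]].
    by rewrite appell_h0 hornerC.
  by rewrite coefZ coefXn; case: i i_gt0 => // i; rewrite mulr0.
rewrite add0r (bigD1_seq m.+1) ?iota_uniq ?mem_index_iota //=.
rewrite big1 ?addr0 => [|i ne_im]; last first.
  by rewrite coefZ coefXn eq_sym (negPf ne_im) mulr0.
by rewrite coefZ coefXn eqxx mulr1 /appell_h hornerZ mulrC.
Qed.

(** This is [f (log f)' = f'] for [f = 1 + u]. The truncated logarithm has derivative [u'] times a
    finite geometric sum in [-u]; multiplying by [1 + u] leaves the error [u' (-u)^k], which is
    divisible by ['X^k] since [u] has no constant term. *)
Lemma deriv_log_trunc (k j : nat) : (j < k)%N ->
  ((log_trunc k)^`() * (1 + fA_trunc A k))`_j = (fA_trunc A k)^`()`_j.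
Proof.
move=> lt_jk; set u := fA_trunc A k.
have -> : (log_trunc k)^`() = u^`() * \sum_(m < k) (- u) ^+ m.
  rewrite /log_trunc raddf_sum big_add1 big_mkord mulr_sumr.
  apply: eq_bigr => m _ /=; rewrite derivZ deriv_exp -scaler_nat scalerA divfK //.
  rewrite !exprS !mulN1r opprK [(- u) ^+ m]exprNn /= -mul_polyC rmorphXn /= polyCN polyC1.
  by rewrite mulrCA.
have -> : u^`() * (\sum_(m < k) (- u) ^+ m) * (1 + u)
    = u^`() - u^`() * (- u) ^+ k.
  have := subrX1 (- u) k; set s := \sum_(m < k) _ => e.
  by rewrite -[(- u) ^+ k](subrK 1) e; ring.
have -> : u = (\sum_(0 <= i < k) ((A i.+1).[0] / (i.+1`!)%:R) *: 'X^i) * 'X.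
  rewrite /u /fA_trunc big_add1 mulr_suml; apply: eq_bigr => i _ /=.
  by rewrite -scalerAl -exprSr.
rewrite coefB -mulNr exprMn mulrA coefMXn lt_jk subr0 //.
Qed.

(** Comparing coefficients in [f' = (log f)' f] gives Newton's identities at [x = 0]. *)
Lemma newton_const (k m : nat) : (m <= k)%N ->
  m%:R * (appell_h m).[0]
    = \sum_(i < m.+1) (i%:R * (log_trunc k)`_i) * (appell_h (m - i)).[0].
Proof.
case: m => [|m] le_mk; first by rewrite big_ord1 !mul0r.
rewrite big_ord_recl !mul0r add0r -(coef_fA_trunc le_mk) coefD coef1 add0r.
have := deriv_log_trunc le_mk; rewrite coef_deriv mulr_natl => <-.
rewrite coefM; apply: eq_bigr => i _; rewrite coef_deriv lift0 subSS.
by rewrite coef_fA_trunc ?mulr_natl //; lia.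
Qed.

(** [i] times the coefficient of [t^i] in [x t + log f_A(t)], the logarithm of the generating
    function of [appell_h]; [k] is the order of truncation. *)
Definition appell_p (k i : nat) : {poly R} :=
  (i%:R * (log_trunc k)`_i)%:P + (i == 1%N)%:R * 'X.

(** Induction on [m]: only [p_1] has a nonzero derivative, namely 1, so by the case [m] the two
    sides for [m + 1] have equal derivatives. They agree at 0 by [newton_const], which suffices in
    characteristic 0. *)
Lemma newton_appell (k m : nat) : (m <= k)%N ->
  m%:R * appell_h m = \sum_(i < m.+1) appell_p k i * appell_h (m - i).
Proof.
elim: m => [|m IHm] le_mk.
  by rewrite big_ord1 /appell_p !mul0r add0r mul0r.
have dh (i : 'I_m.+1) : (appell_h (m.+1 - i))^`() = appell_h (m - i).
  by rewrite subSn ?deriv_appell_h // -ltnS.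
have dp : \sum_(i < m.+2) (appell_p k i)^`() * appell_h (m.+1 - i) = appell_h m.
  rewrite big_ord_recl big_ord_recl big1 ?addr0 => [|i _].
    rewrite /appell_p !derivD !derivC !derivM !derivX.
    rewrite !add0r mul0r !mulr1 -!polyC_natr !derivC !mul0r !add0r /=.
    by rewrite mul0r add0r mul1r subSS subn0.
  by rewrite /appell_p derivD derivC mul0r deriv0 addr0 mul0r.
have ds : \sum_(i < m.+2) appell_p k i * (appell_h (m.+1 - i))^`() = m%:R * appell_h m.
  rewrite big_ord_recr /= subnn appell_h0 derivC mulr0 addr0 IHm 1?ltnW //.
  by apply: eq_bigr => i _; rewrite dh.
have dn : ((m.+1)%:R * appell_h m.+1)^`() = (m.+1)%:R * appell_h m.
  by rewrite -polyC_natr mul_polyC derivZ deriv_appell_h mul_polyC.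
apply/eqP; rewrite -subr_eq0; apply/eqP; apply: poly_eq0_deriv.
  rewrite derivB dn raddf_sum /=.
  under eq_bigr do rewrite derivM.
  by rewrite big_split /= dp ds -natr1 mulrDl mul1r addrC subrr.
rewrite hornerD hornerN hornerM -polyC_natr hornerC (newton_const le_mk).
rewrite horner_sum -sumrB big1 // => i _.
by rewrite hornerM hornerD hornerC hornerM hornerX mulr0 addr0 subrr.
Qed.

Lemma appell_cE (k : nat) : appell_c A k = (k`!)%:R * (log_trunc k)`_k.
Proof. by []. Qed.

End AppellNewton.

(** * Standard tableaux and removal of the largest entry *)

Section Tableaux.
Local Open Scope nat_scope.

Lemma sorted_geq_nth (l : seq nat) (i j : nat) :
  sorted geq l -> i <= j -> nth 0 l j <= nth 0 l i.
Proof.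
move=> l_sorted le_ij; case: (ltnP j (size l)) => [lt_j|le_j]; last first.
  by rewrite nth_default.
have geq_tr : transitive geq by move=> a b c ba ac; exact: leq_trans ac ba.
have lt_i : i < size l by apply: leq_ltn_trans lt_j.
exact: (sorted_leq_nth geq_tr leqnn 0 l_sorted i j lt_i lt_j le_ij).
Qed.

Lemma nth_leq_sumn (l : seq nat) (i : nat) : nth 0 l i <= sumn l.
Proof.
elim: l i => [|a l IHl] [|i] //=; first exact: leq_addr.
exact: leq_trans (IHl i) (leq_addl _ _).
Qed.

Lemma ltn_sumn_of_nth (l : seq nat) (i : nat) :
  sorted geq l -> 0 < nth 0 l i -> i < sumn l.
Proof.
elim: l i => [|a l IHl] [|i] l_sorted //=; first by lia.
move=> l_gt0; have := sorted_geq_nth l_sorted (leq0n i.+1).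
have := IHl i (path_sorted l_sorted) l_gt0; rewrite /=; lia.
Qed.

Lemma sumn_nth_ord (l : seq nat) (N : nat) :
  (forall i, N <= i -> nth 0 l i = 0) -> sumn l = \sum_(i < N) nth 0 l i.
Proof.
elim: l N => [|a l IHl] N l0 /=.
  by rewrite big1 // => i _; rewrite nth_nil.
case: N l0 => [|N] l0.
  rewrite big_ord0 (IHl 0) ?big_ord0 => [|i _]; first by rewrite addn0; apply: (l0 0).
  exact: (l0 i.+1).
by rewrite big_ord_recl /= (IHl N) // => i le_Ni; apply: (l0 i.+1).
Qed.

(** A row emptied in this way stays as a trailing zero, which keeps the number of rows and the
    indexing of the beta numbers fixed; the induction therefore runs over [sorted geq] sequences. *)
Definition dec_row (l : seq nat) (i : nat) : seq nat :=
  set_nth 0 l i (nth 0 l i).-1.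

Lemma nth_dec_row (l : seq nat) (i j : nat) :
  nth 0 (dec_row l i) j = if j == i then (nth 0 l i).-1 else nth 0 l j.
Proof. by rewrite nth_set_nth. Qed.

Lemma sumn_dec_row (l : seq nat) (i n : nat) :
  0 < nth 0 l i -> sumn l = n.+1 -> sumn (dec_row l i) = n.
Proof. by move=> l_gt0 sl; rewrite sumn_set_nth0 sl; lia. Qed.

Lemma size_dec_row (l : seq nat) (i : nat) :
  i < size l -> size (dec_row l i) = size l.
Proof. by move=> lt_il; rewrite size_set_nth; apply/maxn_idPr. Qed.

Lemma dec_row_sorted (l : seq nat) (i : nat) : i < size l ->
  sorted geq l -> nth 0 l i.+1 < nth 0 l i -> sorted geq (dec_row l i).
Proof.
move=> lt_il l_sorted corner; apply/(sortedP 0) => j _.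
rewrite !nth_dec_row /=; have := sorted_geq_nth l_sorted (leqnSn j).
case: eqP => [<-|ne1]; case: eqP => [e|ne2]; try lia.
by rewrite e; lia.
Qed.

Lemma in_diagram_dec_row (l : seq nat) (i : nat) (c : nat * nat) :
  0 < nth 0 l i ->
  in_diagram (dec_row l i) c = in_diagram l c && (c != (i, (nth 0 l i).-1)).
Proof.
move=> l_gt0; rewrite /in_diagram nth_dec_row; case: c => a b /=.
rewrite xpair_eqE; case: eqP => [->|ne_ai] /=; last by rewrite andbT.
by apply/idP/andP => [|[]] ; lia.
Qed.

Lemma card_diagram (l : seq nat) (n : nat) : sorted geq l -> sumn l = n ->
  #|[set c : 'I_n * 'I_n | in_diagram l (nat_of_ord c.1, nat_of_ord c.2)]| = n.
Proof.
move=> l_sorted sl; rewrite -sum1dep_card /in_diagram /=.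
rewrite -(pair_big_dep xpredT (fun i j : 'I_n => j < nth 0 l i) (fun _ _ => 1)) /=.
rewrite -[RHS]sl (@sumn_nth_ord l n) => [|i le_ni]; last first.
  apply/eqP; rewrite -leqn0 leqNgt; apply/negP => /(ltn_sumn_of_nth l_sorted).
  by rewrite sl ltnNge le_ni.
apply: eq_bigr => i _; rewrite -(big_ord_widen n (fun=> 1)) ?sum1_card ?card_ord //.
by rewrite -[X in _ <= X]sl nth_leq_sumn.
Qed.

(** An injection of [n] entries into the [n] cells of the diagram is onto by counting. *)
Lemma SYT_onto (l : seq nat) (n : nat) (T : {ffun 'I_n -> 'I_n * 'I_n}) (x y : nat) :
  sorted geq l -> sumn l = n -> is_SYT l T -> in_diagram l (x, y) ->
  exists a, (x, y) = (nat_of_ord (T a).1, nat_of_ord (T a).2).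
Proof.
move=> l_sorted sl /and3P[/injectiveP T_inj /forallP T_in _] xy_in.
have lt_xn : x < n.
  by rewrite -sl (ltn_sumn_of_nth l_sorted) // (leq_ltn_trans _ xy_in).
have lt_yn : y < n by rewrite -sl (leq_trans xy_in) ?nth_leq_sumn.
pose E := [set c : 'I_n * 'I_n | in_diagram l (nat_of_ord c.1, nat_of_ord c.2)].
have imT : T @: setT = E.
  apply/eqP; rewrite eqEcard card_imset // cardsT card_ord card_diagram // leqnn andbT.
  by apply/subsetP => _ /imsetP[a _ ->]; rewrite inE.
have : (Ordinal lt_xn, Ordinal lt_yn) \in T @: setT by rewrite imT inE.
by case/imsetP => a _ e; exists a; rewrite -e.
Qed.

(** The number of cells is a parameter of its own, so that induction on it does not have to rewrite
    [sumn l] inside the type of [T]. *)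
Definition nSYT_of (n : nat) (l : seq nat) : nat :=
  #|[set T : {ffun 'I_n -> 'I_n * 'I_n} | is_SYT l T]|.

Section RemoveMaximum.

Variables (n : nat) (l : seq nat).
Hypotheses (l_sorted : sorted geq l) (sl : sumn l = n.+1).

(** A cell weakly below and to the right of the largest entry would hold an entry at least as large,
    hence the same one. *)
Lemma SYT_max_corner (T : {ffun 'I_n.+1 -> 'I_n.+1 * 'I_n.+1}) :
  is_SYT l T ->
  nth 0 l (T ord_max).1.+1 < nth 0 l (T ord_max).1
  /\ ((T ord_max).2 = (nth 0 l (T ord_max).1).-1 :> nat).
Proof.
move=> T_SYT; have /and3P[_ /forallP T_in /forallP T_ord] := T_SYT.
have no_cell (x y : nat) : (T ord_max).1 <= x -> (T ord_max).2 <= y ->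
    (x, y) != (nat_of_ord (T ord_max).1, nat_of_ord (T ord_max).2) ->
    ~~ in_diagram l (x, y).
  move=> le_x le_y ne; apply/negP => /(SYT_onto l_sorted sl T_SYT)[a e].
  case: e ne le_x le_y => -> -> ne le_x le_y.
  have /forallP /(_ a) /implyP /(_ le_x) /implyP /(_ le_y) le_a := T_ord ord_max.
  have ea : a = ord_max by apply/val_inj/eqP; rewrite eqn_leq le_a -ltnS ltn_ord.
  by rewrite ea eqxx in ne.
have := T_in ord_max; rewrite /in_diagram /= => lt_max.
have := no_cell (T ord_max).1 (T ord_max).2.+1 (leqnn _) (leqnSn _).
have := no_cell (T ord_max).1.+1 (T ord_max).2 (leqnSn _) (leqnn _).
rewrite /in_diagram /= !xpair_eqE !eqxx /= andbT.
rewrite -!leqNgt => /(_ _) h1 /(_ _) h2.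
by split; lia.
Qed.

Variable x : 'I_n.+1.
Hypothesis corner : nth 0 l x.+1 < nth 0 l x.

Let l_gt0 : 0 < nth 0 l x. Proof. by apply: leq_ltn_trans corner. Qed.

Definition SYT_extend (T : {ffun 'I_n -> 'I_n * 'I_n}) :
    {ffun 'I_n.+1 -> 'I_n.+1 * 'I_n.+1} :=
  [ffun a => if unlift ord_max a is Some b
    then (widen_ord (leqnSn n) (T b).1, widen_ord (leqnSn n) (T b).2)
    else (x, inord (nth 0 l x).-1)].

Let extend_lift T b : SYT_extend T (lift ord_max b)
  = (widen_ord (leqnSn n) (T b).1, widen_ord (leqnSn n) (T b).2).
Proof. by rewrite ffunE liftK. Qed.

Let extend_max T : SYT_extend T ord_max = (x, inord (nth 0 l x).-1).
Proof. by rewrite ffunE unlift_none. Qed.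

Let inordK_last : nat_of_ord (inord (nth 0 l x).-1 : 'I_n.+1) = (nth 0 l x).-1.
Proof. by rewrite inordK //; have := nth_leq_sumn l x; rewrite sl; lia. Qed.

Lemma SYT_extend_inj : injective SYT_extend.
Proof.
move=> T1 T2 eT; apply/ffunP => b.
have := congr1 (fun T : {ffun _} => T (lift ord_max b)) eT; rewrite /= !extend_lift.
move=> [] e1 e2; case: (T1 b) (T2 b) e1 e2 => [a1 b1] [a2 b2] /= e1 e2.
by congr (_, _); apply: val_inj.
Qed.

Lemma SYT_extend_SYT T : is_SYT (dec_row l x) T -> is_SYT l (SYT_extend T).
Proof.
case/and3P => /injectiveP T_inj /forallP T_in /forallP T_ord.
have T_in' b : in_diagram l (nat_of_ord (T b).1, nat_of_ord (T b).2)
    && ((nat_of_ord (T b).1, nat_of_ord (T b).2) != (nat_of_ord x, (nth 0 l x).-1)).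
  by rewrite -in_diagram_dec_row.
apply/and3P; split.
- apply/injectiveP => a1 a2.
  case: (unliftP ord_max a1) => [b1|] ->; case: (unliftP ord_max a2) => [b2|] -> //;
    rewrite ?extend_lift ?extend_max => -[].
  + move=> e1 e2; congr lift; apply: T_inj.
    by case: (T b1) (T b2) e1 e2 => [? ?] [? ?] /= e1 e2; congr (_, _); apply: val_inj.
  + move=> e1 e2; have /andP[_] := T_in' b1.
    move/(congr1 val): e2; rewrite /= inordK_last => e2.
    by rewrite e2 -e1 eqxx.
  + move=> e1 e2; have /andP[_] := T_in' b2.
    move/(congr1 val): e2; rewrite /= inordK_last => e2.
    by rewrite -e2 e1 eqxx.
- apply/forallP => a; case: (unliftP ord_max a) => [b|] ->.
    by rewrite extend_lift /=; case/andP: (T_in' b).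
  by rewrite extend_max /= inordK_last /in_diagram /=; lia.
- apply/forallP => a1; apply/forallP => a2; apply/implyP => le1; apply/implyP => le2.
  case: (unliftP ord_max a2) le1 le2 => [b2|] -> le1 le2; last by rewrite leq_ord.
  case: (unliftP ord_max a1) le1 le2 => [b1|] ->.
    rewrite !extend_lift !lift_max /= => le1 le2.
    by have /forallP /(_ b2) /implyP /(_ le1) /implyP /(_ le2) := T_ord b1.
  (* No other cell lies weakly below and to the right of the corner: lower rows end before its
     column, and in row [x] it is the last cell. *)
  rewrite extend_lift extend_max /= inordK_last => le1 le2.
  have /andP[] := T_in' b2; rewrite /in_diagram /= xpair_eqE.
  case: (ltngtP x (T b2).1) le1 => // lt_x _ h1.
    by have := sorted_geq_nth l_sorted lt_x; lia.
  by rewrite -lt_x in h1; rewrite /=; lia.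
Qed.

(** [SYT_extend] is injective, and it reaches every such tableau: forgetting the largest entry
    leaves cells inside [dec_row l x], whose coordinates are below [n]. *)
Lemma card_SYT_max_row :
  #|[set T : {ffun 'I_n.+1 -> 'I_n.+1 * 'I_n.+1} | is_SYT l T && ((T ord_max).1 == x)]|
    = nSYT_of n (dec_row l x).
Proof.
rewrite /nSYT_of -(card_imset _ SYT_extend_inj); congr #|pred_of_set _|.
apply/setP => T; rewrite inE; apply/andP/imsetP => [[T_SYT /eqP Tx]|[T']]; last first.
  rewrite inE => T_SYT ->; split; first exact: SYT_extend_SYT.
  by rewrite extend_max.
have [_ Ty] := SYT_max_corner T_SYT; rewrite Tx in Ty.
have /and3P[/injectiveP T_inj /forallP T_in /forallP T_ord] := T_SYT.
have T_dec (b : 'I_n) : in_diagram (dec_row l x)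
    (nat_of_ord (T (lift ord_max b)).1, nat_of_ord (T (lift ord_max b)).2).
  rewrite in_diagram_dec_row // T_in /=; apply/eqP => -[e1 e2].
  have /T_inj /eqP : T (lift ord_max b) = T ord_max.
    case eT: (T ord_max) Tx Ty => [u v] /= Tx Ty.
    case: (T (lift ord_max b)) e1 e2 => [u' v'] /= e1 e2.
    by congr (_, _); apply: val_inj => /=; rewrite ?Tx ?Ty.
  by rewrite eq_sym (negPf (neq_lift _ _)).
have corner_lt : x < size l.
  by rewrite ltnNge; apply/negP => le; move: l_gt0; rewrite nth_default.
have dec_sorted := dec_row_sorted corner_lt l_sorted corner.
have s_dec := sumn_dec_row l_gt0 sl.
have lt1 b : (T (lift ord_max b)).1 < n.
  by rewrite -[X in _ < X]s_dec (ltn_sumn_of_nth dec_sorted) // (leq_ltn_trans _ (T_dec b)).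
have lt2 b : (T (lift ord_max b)).2 < n.
  by rewrite -[X in _ < X]s_dec (leq_trans (T_dec b)) ?nth_leq_sumn.
pose T' : {ffun 'I_n -> 'I_n * 'I_n} := [ffun b => (Ordinal (lt1 b), Ordinal (lt2 b))].
exists T'; last first.
  apply/ffunP => a; case: (unliftP ord_max a) => [b|] ->.
    rewrite extend_lift ffunE /=; case: (T (lift ord_max b)) (lt1 b) (lt2 b) => u v /= ? ?.
    by congr (_, _); apply: val_inj.
  rewrite extend_max; case: (T ord_max) Tx Ty => u v /= -> Ty.
  by congr (_, _); apply: val_inj; rewrite /= inordK_last.
rewrite inE; apply/and3P; split.
- apply/injectiveP => b1 b2; rewrite !ffunE => -[e1 e2].
  apply: (@lift_inj _ ord_max); apply: T_inj.
  case: (T (lift ord_max b1)) (T (lift ord_max b2)) e1 e2 => [? ?] [? ?] /= e1 e2.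
  by congr (_, _); apply: val_inj.
- by apply/forallP => b; rewrite ffunE /= T_dec.
- apply/forallP => b1; apply/forallP => b2; rewrite !ffunE /=.
  have /forallP /(_ (lift ord_max b2)) := T_ord (lift ord_max b1).
  by rewrite !lift_max.
Qed.

End RemoveMaximum.

Lemma nSYT_of_rec (n : nat) (l : seq nat) : sorted geq l -> sumn l = n.+1 ->
  nSYT_of n.+1 l
    = \sum_(i < size l | nth 0 l i.+1 < nth 0 l i) nSYT_of n (dec_row l i).
Proof.
move=> l_sorted sl; rewrite /nSYT_of -sum1dep_card.
rewrite (partition_big (fun T : {ffun 'I_n.+1 -> _} => (T ord_max).1) xpredT) //=.
transitivity (\sum_(i < n.+1 | nth 0 l i.+1 < nth 0 l i) nSYT_of n (dec_row l i)).
  rewrite [RHS]big_mkcond; apply: eq_bigr => x _; case: ifP => corner.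
    by rewrite -(card_SYT_max_row l_sorted sl corner) -sum1dep_card.
  rewrite big_pred0 // => T; apply/negbTE/negP => /andP[T_SYT /eqP Tx].
  by have [] := SYT_max_corner l_sorted sl T_SYT; rewrite Tx corner.
(* A corner row is nonempty, hence below both [n.+1] and [size l]; the two ranges are compared
   inside a common larger one. *)
rewrite (big_ord_widen_cond (n.+1 + size l) (fun i => nth 0 l i.+1 < nth 0 l i)
  (fun i => nSYT_of n (dec_row l i))) ?leq_addr //.
rewrite [RHS](big_ord_widen_cond (n.+1 + size l) (fun i => nth 0 l i.+1 < nth 0 l i)
  (fun i => nSYT_of n (dec_row l i))) ?leq_addl //.
apply: eq_bigl => i; case: ltnP => //= corner.
rewrite -[X in _ < X]sl (ltn_sumn_of_nth l_sorted) ?(leq_ltn_trans _ corner) //.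
by apply/esym; rewrite ltnNge; apply/negP => le; rewrite [nth 0 l i]nth_default in corner.
Qed.

End Tableaux.

(** * Beta numbers, Frobenius' formula and the passage to Jacobi-Trudi determinants *)

Definition beta (r : nat) (l : seq nat) (i : nat) : nat :=
  (nth 0 l (r - i.+1) + i)%N.

Lemma det_eq_cols (S : comNzRingType) (r : nat) (M : 'M[S]_r) (a b : 'I_r) :
  a != b -> (forall i, M i a = M i b) -> \det M = 0.
Proof.
move=> ne_ab eM; rewrite -det_tr; apply: (determinant_alternate ne_ab) => i.
by rewrite !mxE.
Qed.

Lemma sum_beta (r : nat) (l : seq nat) : (size l <= r)%N ->
  (\sum_(j < r) beta r l j = sumn l + \sum_(j < r) j)%N.
Proof.
move=> le_lr; rewrite big_split /=; congr addn.
rewrite (@sumn_nth_ord l r) => [|i le_ri]; last by rewrite nth_default ?(leq_trans le_lr).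
by rewrite [RHS](reindex_inj rev_ord_inj).
Qed.

(** Beta numbers read the rows from the bottom, so removing a cell from row [i] lowers the beta
    number of index [rev_ord i] by one. Rows that are not corners may be included, as their terms
    vanish, and [sum_vandermonde_pred] evaluates the full sum. *)
Lemma frobenius_formula (S : comNzRingType) (n : nat) (l : seq nat) :
  sorted geq l -> sumn l = n ->
  (nSYT_of n l)%:R * \prod_(i < size l) ((beta (size l) l i)`!)%:R
  = (n`!)%:R * \det (\matrix_(i < size l, j < size l) ((beta (size l) l j) ^_ i)%:R)
  :> S.
Proof.
elim: n l => [|n IHn] l l_sorted sl.
  have betaE i : beta (size l) l i = i.
    by rewrite /beta; have := nth_leq_sumn l (size l - i.+1); rewrite sl; lia.
  have -> : nSYT_of 0 l = 1%N.
    rewrite /nSYT_of; apply: (@eq_card1 _ [ffun i : 'I_0 => (i, i)]) => T.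
    rewrite !inE; have -> : T = [ffun i : 'I_0 => (i, i)] by apply/ffunP => -[].
    by rewrite eqxx; apply/and3P; split; [apply/injectiveP => -[]|apply/forallP => -[]..].
  rewrite fact0 !mul1r -det_tr det_trig.
    by apply: eq_bigr => i _; rewrite !mxE betaE ffactnn.
  by apply/is_trig_mxP => i j lt_ij; rewrite !mxE betaE ffact_small.
set r := size l; pose x := beta r l.
pose E (j : 'I_r) : 'M[S]_r :=
  \matrix_(a, b) ((if b == j then (x b).-1 else x b) ^_ a)%:R.
have term (i : 'I_r) :
    (if (nth 0 l i.+1 < nth 0 l i)%N then (nSYT_of n (dec_row l i))%:R else 0)
      * (\prod_(b < r) ((x b)`!)%:R)
    = (n`!)%:R * ((x (rev_ord i))%:R * \det (E (rev_ord i))) :> S.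
  case: ltnP => [corner|non_corner]; last first.
    (* Without a corner, either the last row is empty and its beta number is 0, or the lowered beta
       number equals the one before it and two columns coincide. *)
    rewrite mul0r; case: (posnP (rev_ord i)) => [e|j_gt0].
      have -> : x (rev_ord i) = 0%N; last by rewrite mul0r mulr0.
      rewrite /x /beta e; have ei : (i.+1 = r)%N by move: e => /=; have := ltn_ord i; lia.
      have : (nth 0 l i.+1 = 0)%N by rewrite nth_default // ei.
      have -> : (r - 1 = i)%N by lia.
      by lia.
    have lt_j1 : ((rev_ord i).-1 < r)%N by rewrite (leq_ltn_trans (leq_pred _)).
    rewrite (@det_eq_cols _ _ _ (rev_ord i) (Ordinal lt_j1)) ?mulr0 //.
      by rewrite -val_eqE /=; move: j_gt0 => /=; lia.
    move=> a; rewrite !mxE eqxx -val_eqE /=.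
    have -> : ((r - i.+1).-1 == r - i.+1)%N = false by move: j_gt0 => /=; lia.
    congr ((_ ^_ a)%:R); rewrite /x /beta /=.
    have := sorted_geq_nth l_sorted (leqnSn i).
    have -> : (r - (r - i.+1).+1 = i)%N by have := ltn_ord i; lia.
    have -> : (r - (r - i.+1).-1.+1 = i.+1)%N by move: j_gt0 => /=; lia.
    by move: j_gt0 => /=; lia.
  have l_gt0 : (0 < nth 0 l i)%N by apply: leq_ltn_trans corner.
  have := IHn (dec_row l i) (dec_row_sorted (ltn_ord i) l_sorted corner)
    (sumn_dec_row l_gt0 sl).
  rewrite size_dec_row // -/r.
  have decE (b : 'I_r) : beta r (dec_row l i) b
      = if b == rev_ord i then (x b).-1 else x b.
    rewrite /beta nth_dec_row -val_eqE /=.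
    have -> : (r - b.+1 == i)%N = (b == (r - i.+1)%N :> nat).
      by apply/eqP/eqP => ?; have := ltn_ord i; have := ltn_ord b; lia.
    case: eqP => // eb; rewrite /x /beta.
    have -> : (r - b.+1 = i)%N by have := ltn_ord i; lia.
    by lia.
  have -> : \matrix_(a < r, b < r) ((beta r (dec_row l i) b) ^_ a)%:R = E (rev_ord i).
    by apply/matrixP => a b; rewrite !mxE decE.
  rewrite mulrCA => <-; rewrite mulrCA; congr (_ * _).
  rewrite (bigD1 (rev_ord i)) // [in RHS](bigD1 (rev_ord i)) // decE eqxx.
  rewrite mulrA -natrM; congr (_%:R * _).
    have : (0 < x (rev_ord i))%N.
      rewrite /x /beta /=; have -> : (r - (r - i.+1).+1 = i)%N by have := ltn_ord i; lia.
      by rewrite addn_gt0 l_gt0.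
    by case: (x (rev_ord i)) => // y _; rewrite factS.
  by apply: eq_bigr => b ne; rewrite decE (negPf ne).
rewrite nSYT_of_rec // natr_sum big_mkcond mulr_suml /=.
rewrite (eq_bigr _ (fun i _ => term i)) -mulr_sumr (reindex_inj rev_ord_inj).
under eq_bigr do rewrite rev_ordK.
(* The beta numbers exceed the staircase [0, ..., r - 1] by [sumn l = n.+1] in total, the factor
   that turns [n!] into [(n + 1)!]. *)
rewrite [X in _ * X](sum_vandermonde_pred S r x) factS natrM mulrCA mulrA; congr (_ * _ * _).
rewrite -!natr_sum sum_beta // natrD addrK sl //.
Qed.

Lemma nth_wr_indices (l : seq nat) (i : nat) : (i < size l)%N ->
  (nth 0 (wr_indices l) i = beta (size l) l i)%N.
Proof. by move=> lt_il; rewrite (nth_map 0%N) ?size_iota // nth_iota. Qed.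

Lemma ltn_beta (r : nat) (l : seq nat) (i j : nat) :
  sorted geq l -> (i < j)%N -> (beta r l i < beta r l j)%N.
Proof.
move=> l_sorted lt_ij; rewrite /beta.
by have := @sorted_geq_nth l (r - j.+1) (r - i.+1) l_sorted ltac:(lia); lia.
Qed.

(** The column factorials of the Wronskian come out as a diagonal matrix, and Frobenius' formula
    trades them, with the tableau count, for [(sumn l)!] times the Vandermonde product. That product
    cancels: the beta numbers are distinct and the characteristic is 0. *)
Lemma nSYT_Apart (R : fieldType) (A : nat -> {poly R}) (l : seq nat) :
  [pchar R] =i pred0 -> is_Appell A -> is_partition l ->
  (nSYT l)%:R *: Apart A l
    = ((sumn l)`!)%:R *: jt_det (appell_h A) (size l) (beta (size l) l).
Proof.
move=> charR0 HA /andP[l_sorted _]; set r := size l; pose b := beta r l.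
have size_wr : size (wr_indices l) = r by rewrite size_map size_iota.
have vdmE : vandermonde R (wr_indices l)
    = \det (\matrix_(i < r, j < r) ((b j) ^_ i)%:R).
  rewrite det_ffact /vandermonde size_wr; apply: eq_bigr => i _; apply: eq_bigr => j _.
  by rewrite !nth_wr_indices.
have vdm_neq0 : vandermonde R (wr_indices l) != 0.
  rewrite vdmE det_ffact; apply/prodf_neq0 => i _; apply/prodf_neq0 => j lt_ij.
  rewrite -natrB; last by rewrite ltnW // ltn_beta.
  by rewrite (pcharf0P R).1 // -lt0n subn_gt0 ltn_beta.
have wrE : wronskian [seq A n | n <- wr_indices l]
    = (\prod_(j < r) ((b j)`!)%:R) *: jt_det (appell_h A) r b.
  have -> : wronskian [seq A n | n <- wr_indices l] = 
      \det (\matrix_(i < r, j < r) (A (b j))^`(i)).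
    rewrite /wronskian size_map size_wr; congr (\det _); apply/matrixP => i j.
    by rewrite !mxE (nth_map 0%N) ?size_wr ?nth_wr_indices.
  rewrite -mul_polyC rmorph_prod /= mulrC.
  transitivity (\det ((\matrix_(i < r, j < r) toep (appell_h A) (b j) i)
      *m diag_mx (\row_(j < r) ((b j)`!)%:R)) : {poly R}); last first.
    rewrite det_mulmx det_diag; congr (_ * _); apply: eq_bigr => j _.
    by rewrite mxE polyC_natr.
  congr (\det _); apply/matrixP => i j; rewrite mul_mx_diag !mxE.
  by rewrite derivn_appell // -mul_polyC polyC_natr mulrC.
rewrite /Apart wrE !scalerA; congr (_ *: _).
have := frobenius_formula R l_sorted (erefl (sumn l)); rewrite -/r -vdmE => F.
by rewrite mulrAC F mulfK.
Qed.

(** One more empty row shifts the beta numbers by one and adds a beta number 0, whose column is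
    [(1, 0, ..., 0)]; expanding along it restores the smaller matrix. *)
Lemma jt_det_pad (S : comNzRingType) (h : nat -> S) (l : seq nat) (r : nat) :
  h 0%N = 1 -> (size l <= r)%N ->
  jt_det h r (beta r l) = jt_det h (size l) (beta (size l) l).
Proof.
move=> h0 /subnKC <-; elim: (r - size l)%N => [|d IHd]; first by rewrite addn0.
rewrite addnS -{}IHd; set r' := (size l + d)%N.
have col0 : beta r'.+1 l 0 = 0%N by rewrite /beta nth_default // subn1 leq_addr.
rewrite /jt_det (expand_det_col _ ord0) big_ord_recl big1 => [|i _]; last first.
  by rewrite !mxE /= col0 /toep mul0r.
rewrite addr0 !mxE /= col0 /toep leqnn subnn h0 mul1r /cofactor expr0 mul1r.
congr (\det _); apply/matrixP => i j; rewrite !mxE /toep /= /bump /=.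
by rewrite /beta !add1n subSS addnS ltnS subSS.
Qed.

(** * Adding [k] to one beta number and sorting again *)

Section BetaMoves.
Local Open Scope nat_scope.

(* Add [k] to the [j]-th entry of an increasing sequence and reinsert the
   result at position [s >= j]. *)
Definition move (k : nat) (n : nat -> nat) (j s i : nat) : nat :=
  if i < j then n i else if i < s then n i.+1 else if i == s then n j + k else n i.

Lemma move_lift (k : nat) (n : nat -> nat) (r : nat) (j s : 'I_r.+1) (i : 'I_r) :
  j <= s -> move k n j s (lift s i) = n (lift j i).
Proof.
move=> le_js; rewrite /move /= /bump.
case: (leqP s i) => h1; case: (leqP j i) => h2 //=; rewrite ?add1n ?add0n; try lia.
- by rewrite !ifF; try lia; congr n; lia.
- by rewrite h1.
Qed.

Lemma move_at (k : nat) (n : nat -> nat) (j s : nat) :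
  j <= s -> move k n j s s = n j + k.
Proof. by move=> le_js; rewrite /move ltnNge le_js ltnn eqxx. Qed.

Lemma sum_move (k : nat) (n : nat -> nat) (r : nat) (j s : 'I_r) :
  j <= s -> \sum_(i < r) move k n j s i = \sum_(i < r) n i + k.
Proof.
case: r j s => [[] //|r] j s le_js.
rewrite (bigD1_ord s) //= [in RHS](bigD1_ord j) //= move_at // addnAC; congr (_ + _ + _).
by apply: eq_bigr => i _; rewrite move_lift.
Qed.

(** Sorting applies to the columns the cycle [lift_perm j s 1], whose sign is [(-1)^(s - j)]. *)
Lemma jt_det_move (S : comNzRingType) (h : nat -> S) (k : nat) (n : nat -> nat)
    (r : nat) (j s : 'I_r) : j <= s ->
  jt_det h r (fun i => if i == j :> nat then n i + k else n i)
    = ((-1) ^+ (s - j) * jt_det h r (move k n j s))%R.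
Proof.
case: r j s => [[] //|r] j s le_js.
rewrite /jt_det; set M := (\matrix_(a, b) toep h (move k n j s b) a)%R.
transitivity (\det (col_perm (lift_perm j s 1) M))%R.
  congr (determinant _); apply/matrixP => a b; rewrite !mxE; congr toep.
  case: (unliftP j b) => [i|] ->.
    rewrite lift_perm_lift perm1 move_lift // ifF //.
    by apply/eqP => /val_inj/eqP; rewrite eq_sym (negPf (neq_lift _ _)).
  by rewrite lift_perm_id eqxx move_at.
rewrite col_permE det_mulmx det_perm odd_permV odd_lift_perm odd_perm1 addbF mulrC.
by rewrite addbC -oddB // signr_odd.
Qed.

(** [j] is the first position at which the moved sequence differs from [n]. *)
Lemma move_inj (k : nat) (n : nat -> nat) (r j s j' s' : nat) : 0 < k ->
  (forall a b, a < b -> n a < n b) -> j <= s -> s < r -> j' <= s' -> s' < r ->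
  (forall i, i < r -> move k n j s i = move k n j' s' i) -> j = j'.
Proof.
move=> k_gt0 n_incr.
wlog lt_jj : j s j' s' / j < j'.
  move=> wl le1 lt1 le2 lt2 e; case: (ltngtP j j') => // lt.
    exact: (wl j s j' s').
  by apply/esym; apply: (wl j' s' j s) => // i lt_i; rewrite e.
move=> le1 lt1 le2 lt2 /(_ j (leq_ltn_trans le1 lt1)).
rewrite /move lt_jj ltnn; have := n_incr j j.+1 (leqnn _).
by case: (ltngtP j s) le1 => //; lia.
Qed.

(* The insertion position is determined: the entries below [n j + k] are
   exactly those with index at most [s]. *)
Lemma move_position (k : nat) (n m : nat -> nat) (r j s i : nat) : 0 < k ->
  (forall a b, a < b -> n a < n b) -> (forall a b, a < b -> m a < m b) ->
  j <= s -> s < r -> (forall a, a < r -> m a = move k n j s a) ->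
  i < r -> (i <= s) = (n i < n j + k) /\ n i != n j + k.
Proof.
move=> k_gt0 n_incr m_incr le_js lt_sr mE lt_ir.
have ms : m s = n j + k by rewrite mE // move_at.
case: (ltngtP i s) => [lt_is|lt_si|->]; last first.
- case: (ltngtP j s) le_js => // [lt_js _|<- _]; last by lia.
  have := m_incr s.-1 s ltac:(lia).
  rewrite ms (mE s.-1) ?/move; last by lia.
  by rewrite ifF ?ifT; try lia; rewrite prednK; lia.
- have := m_incr _ _ lt_si; rewrite ms mE // /move !ifF; try lia.
- have [lt_ij|le_ji] := ltnP i j; first by have := n_incr _ _ lt_ij; lia.
  have [->|ne_ij] := eqVneq i j; first by lia.
  have := m_incr i.-1 s ltac:(lia).
  rewrite ms (mE i.-1) ?/move; last by lia.
  by rewrite ifF ?ifT; try lia; rewrite prednK; lia.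
Qed.

Lemma nth_filter_pos (s : seq nat) (i : nat) : sorted geq s ->
  nth 0 [seq x <- s | 0 < x] i = nth 0 s i.
Proof.
elim: s i => [|a s IHs] i s_sorted //=; case: posnP => [a0|a_gt0].
  have s0 j : nth 0 (a :: s) j = 0.
    by have := sorted_geq_nth s_sorted (leq0n j); rewrite a0 /=; lia.
  rewrite -[RHS]/(nth 0 (a :: s) i) s0 IHs ?(path_sorted s_sorted) //.
  exact: (s0 i.+1).
by case: i => [|i] //=; rewrite IHs // (path_sorted s_sorted).
Qed.

(** Strict increase forces [i <= m i], so subtracting the staircase is exact and leaves weakly
    decreasing rows; the zero rows are then dropped. *)
Lemma partition_of_beta (r : nat) (m : nat -> nat) :
  (forall i, i.+1 < r -> m i < m i.+1) ->
  exists g, [/\ is_partition g, size g <= r & forall i, i < r -> beta r g i = m i].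
Proof.
move=> m_incr.
have m_ge i : i < r -> i <= m i.
  by elim: i => // i IHi lt_ir; have := m_incr i lt_ir; have := IHi ltac:(lia); lia.
pose row i := m (r - i.+1) - (r - i.+1).
pose s := mkseq row r; pose g := [seq x <- s | 0 < x].
have s_sorted : sorted geq s.
  apply/(sortedP 0) => i; rewrite size_mkseq => lt_ir; rewrite !nth_mkseq //; last by lia.
  rewrite /row /=; have := m_incr (r - i.+2) ltac:(lia).
  have -> : (r - i.+2).+1 = r - i.+1 by lia.
  by lia.
exists g; split.
- apply/andP; split; last by rewrite filter_all.
  by apply: sorted_filter s_sorted => a b c ba ac; exact: leq_trans ac ba.
- by rewrite size_filter (leq_trans (count_size _ _)) // size_mkseq.
- move=> i lt_ir; rewrite /beta nth_filter_pos // nth_mkseq; last by lia.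
  rewrite /row; have -> : r - (r - i.+1).+1 = i by lia.
  by rewrite subnK // m_ge.
Qed.

Lemma partition_inj (g g' : seq nat) :
  is_partition g -> is_partition g' -> (forall i, nth 0 g i = nth 0 g' i) -> g = g'.
Proof.
move=> /andP[_ g_pos] /andP[_ g'_pos] eg.
have le_size (u v : seq nat) : all (fun x => 0 < x) u ->
    (forall i, nth 0 u i = nth 0 v i) -> size u <= size v.
  move=> u_pos e; rewrite leqNgt; apply/negP => lt_vu.
  by have := all_nthP 0 u_pos _ lt_vu; rewrite e nth_default.
apply: (@eq_from_nth _ 0) => [|i _]; last exact: eg.
by apply/eqP; rewrite eqn_leq !le_size.
Qed.

Lemma beta_inj (r : nat) (g g' : seq nat) : is_partition g -> is_partition g' ->
  size g <= r -> size g' <= r -> (forall i, i < r -> beta r g i = beta r g' i) ->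
  g = g'.
Proof.
move=> Pg Pg' sg sg' e; apply: partition_inj => // i.
have [lt_ir|le_ri] := ltnP i r; last by rewrite !nth_default // (leq_trans _ le_ri).
have := e (r - i.+1) ltac:(lia); rewrite /beta.
have -> : r - (r - i.+1).+1 = i by lia.
by lia.
Qed.

Lemma mem_allseqs (M len : nat) (s : seq nat) :
  size s <= len -> all (fun x => 0 < x <= M) s -> s \in allseqs M len.
Proof.
elim: len s => [|len IHlen] [|a s] //= lt_s /andP[a_in s_in].
rewrite inE /=; apply/allpairsP; exists (a, s); split => //=.
  by rewrite mem_iota; lia.
exact: IHlen.
Qed.

(** A partition of [n] has at most [n] parts, each at most [n], so the bounded enumeration misses
    none. *)
Lemma mem_partitions_of (n : nat) (g : seq nat) :
  (g \in partitions_of n) = is_partition g && (sumn g == n).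
Proof.
rewrite mem_undup mem_filter andb_idr // => /andP[/andP[_ g_pos] /eqP <-].
apply: mem_allseqs; last first.
  apply/allP => x x_in; rewrite (allP g_pos) //=.
  by rewrite -(nth_index 0 x_in) nth_leq_sumn.
by elim: g g_pos => //= a g IHg /andP[a_gt0 /IHg]; lia.
Qed.

End BetaMoves.

(** * Rim hooks: from skew diagrams to rows to beta numbers *)

Section RimHooks.
Local Open Scope nat_scope.

(* Row form of a rim hook: it occupies rows [s] to [t], and each row but the
   top one ends exactly one column past the start of the row above. *)
Definition is_rim (l g : seq nat) (s t : nat) : Prop :=
  [/\ s <= t,
      forall i, (i < s) || (t < i) -> nth 0 g i = nth 0 l i,
      forall i, s <= i < t -> nth 0 g i.+1 = (nth 0 l i).+1
    & nth 0 l s < nth 0 g s].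

Lemma subpart_nth (l g : seq nat) (i : nat) :
  subpart l g -> nth 0 l i <= nth 0 g i.
Proof.
move=> /allP sub; have [lt_il|le_li] := ltnP i (size l); last by rewrite nth_default.
by apply: sub; rewrite mem_iota.
Qed.

(** Otherwise columns [nth 0 l i] and [(nth 0 l i).+1] of rows [i] and [i.+1] would form a
    square. *)
Lemma no_square_row (l g : seq nat) (i : nat) : sorted geq g ->
  sorted geq l -> skew_no_square l g -> nth 0 g i.+1 <= (nth 0 l i).+1.
Proof.
move=> g_sorted l_sorted nsq; rewrite leqNgt; apply/negP => lt_lg.
have g_mon := sorted_geq_nth g_sorted (leqnSn i).
have l_mon := sorted_geq_nth l_sorted (leqnSn i).
have lt_i : i < sumn g by apply: ltn_sumn_of_nth => //; lia.
have lt_j : nth 0 l i < sumn g by have := nth_leq_sumn g i; lia.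
case/negP: nsq; apply/existsP; exists (Ordinal lt_i).
apply/existsP; exists (Ordinal lt_j); rewrite /in_skew /in_diagram /=.
by apply/and4P; split; lia.
Qed.

(** A vertical step between rows [i] and [i.+1] needs a column that is at least [nth 0 l i] and
    below [nth 0 g i.+1]. Without one, the rows up to [i] are closed under adjacency and separate
    row [a] from row [b]. *)
Lemma connected_row (l g : seq nat) (a b i : nat) : sorted geq g ->
  skew_connected l g -> a <= i -> i < b ->
  nth 0 l a < nth 0 g a -> nth 0 l b < nth 0 g b -> nth 0 l i < nth 0 g i.+1.
Proof.
move=> g_sorted conn le_ai lt_ib la lb; rewrite ltnNge; apply/negP => le_gl.
have row_lt c : nth 0 l c < nth 0 g c -> c < sumn g.
  by move=> lc; apply: ltn_sumn_of_nth => //; lia.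
have col_lt c : nth 0 l c < nth 0 g c -> nth 0 l c < sumn g.
  by move=> lc; apply: leq_trans lc (nth_leq_sumn _ _).
pose ca := (Ordinal (row_lt a la), Ordinal (col_lt a la)).
pose cb := (Ordinal (row_lt b lb), Ordinal (col_lt b lb)).
pose P := [pred c : 'I_(sumn g) * 'I_(sumn g) | c.1 <= i].
have P_closed : closed (@skew_adj l g (sumn g)) P.
  move=> [c1 c2] [d1 d2] /and3P[]; rewrite /in_skew /in_diagram !inE /= => hc hd.
  case/orP => /andP[/eqP e1 h]; first by rewrite e1.
  apply/idP/idP => h1; rewrite leqNgt; apply/negP => h2.
    have e : d1 = i.+1 :> nat by case/orP: h => /eqP; lia.
    have ec : c1 = i :> nat by case/orP: h => /eqP; lia.
    by move: hc hd; rewrite e ec; lia.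
  have e : c1 = i.+1 :> nat by case/orP: h => /eqP; lia.
  have ec : d1 = i :> nat by case/orP: h => /eqP; lia.
  by move: hc hd; rewrite e ec; lia.
have /forallP /(_ ca) /forallP /(_ cb) := conn.
rewrite /in_skew /in_diagram /= la lb !ltnn /= => /(closed_connect P_closed).
by rewrite !inE /= le_ai; lia.
Qed.

Lemma sumn_nth_wide (l g : seq nat) :
  sumn l = \sum_(i < size l + size g) nth 0 l i.
Proof.
apply: sumn_nth_ord => i le_i; rewrite nth_default //.
exact: leq_trans (leq_addr _ _) le_i.
Qed.

Lemma exists_grown_row (l g : seq nat) : subpart l g -> sumn l < sumn g ->
  exists i, nth 0 l i < nth 0 g i.
Proof.
move=> sub lt_lg.
have [/existsP[i lt_i]|no_row] :=
  boolP [exists i : 'I_(size g + size l), nth 0 l i < nth 0 g i].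
  by exists i.
move: lt_lg; rewrite (sumn_nth_wide l g) (sumn_nth_wide g l) addnC ltnNge.
case/negP; apply: leq_sum => i _; rewrite leqNgt; apply/negP => lt_i.
by case/existsP: no_row; exists i.
Qed.

(** Take for [s] and [t] the first and last rows that grow; absence of squares and connectedness
    give the two inequalities fixing each row end in between. *)
Lemma rim_hook_is_rim (k : nat) (l g : seq nat) : sorted geq l -> sorted geq g ->
  0 < k -> rim_hook k l g -> exists s t, is_rim l g s t.
Proof.
move=> l_sorted g_sorted k_gt0 /and4P[sub /eqP sg conn nsq].
have sub_nth i := subpart_nth i sub.
have row_lt c : nth 0 l c < nth 0 g c -> c <= sumn g.
  by move=> lc; apply: ltnW; apply: ltn_sumn_of_nth => //; lia.
have ex_row := exists_grown_row sub ltac:(lia).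
case: (ex_minnP ex_row) => s lt_s s_min.
case: (ex_maxnP ex_row row_lt) => t lt_t t_max.
exists s, t; split => //; first exact: s_min.
- move=> i out; apply/eqP; rewrite eqn_leq sub_nth andbT leqNgt; apply/negP => lt_i.
  by have := s_min i lt_i; have := t_max i lt_i; lia.
- move=> i /andP[le_si lt_it]; apply/eqP; rewrite eqn_leq no_square_row //=.
  exact: (connected_row g_sorted conn le_si lt_it lt_s lt_t).
Qed.

Section RimFacts.

Variables (l g : seq nat) (s t : nat).
Hypothesis l_sorted : sorted geq l.
Hypothesis rim : is_rim l g s t.

Lemma is_rim_row (i : nat) : (nth 0 l i < nth 0 g i) = (s <= i <= t).
Proof.
case: rim => le_st out inn top.
have [in_i|out_i] := boolP (s <= i <= t); last by rewrite out ?ltnn //; lia.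
have [->|ne_is] := eqVneq i s; first by [].
have := inn i.-1 ltac:(lia); have := sorted_geq_nth l_sorted (leq_pred i).
by rewrite prednK; lia.
Qed.

Lemma is_rim_leq (i : nat) : nth 0 l i <= nth 0 g i.
Proof.
case: (boolP (s <= i <= t)) => [|out_i]; first by rewrite -is_rim_row => /ltnW.
by case: rim => _ out _ _; rewrite out //; lia.
Qed.

Lemma is_rim_subpart : subpart l g.
Proof. by apply/allP => i _; apply: is_rim_leq. Qed.

Lemma is_rim_no_square : skew_no_square l g.
Proof.
apply/negP => /existsP[i /existsP[j /and4P[]]]; rewrite /in_skew /in_diagram /=.
case: rim => le_st out inn top h1 _ _ h2.
have := is_rim_row i; have := is_rim_row i.+1.
have [in_i|] := boolP (s <= i < t); first by have := inn i in_i; lia.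
by lia.
Qed.

Lemma is_rim_height : rim_height l g = t - s.
Proof.
have lt_tg : t < size g.
  rewrite ltnNge; apply/negP => le; have := is_rim_row t.
  by rewrite (nth_default _ le); case: rim; lia.
rewrite /rim_height (eq_count is_rim_row).
have le_st : s <= t by case: rim.
have -> : size g = s + ((t - s).+1 + (size g - t.+1)) by lia.
rewrite !iotaD !count_cat add0n.
rewrite (@eq_in_count _ _ pred0) => [|i]; last by rewrite mem_iota /=; lia.
rewrite [X in _ + (X + _)](@eq_in_count _ _ predT) => [|i]; last by rewrite mem_iota /=; lia.
rewrite [X in _ + (_ + X)](@eq_in_count _ _ pred0) => [|i]; last by rewrite mem_iota /=; lia.
by rewrite !count_pred0 count_predT size_iota addn0.
Qed.

Hypothesis g_sorted : sorted geq g.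

Lemma is_rim_connected : skew_connected l g.
Proof.
have lt_sg : s < sumn g.
  by apply: ltn_sumn_of_nth => //; case: rim => _ _ _; lia.
have lt_eg : (nth 0 g s).-1 < sumn g.
  by have := nth_leq_sumn g s; case: rim => _ _ _; lia.
pose e := @skew_adj l g (sumn g).
pose base : 'I_(sumn g) * 'I_(sumn g) := (Ordinal lt_sg, Ordinal lt_eg).
have e_sym : symmetric e.
  move=> c d; apply/and3P/and3P => -[h1 h2 h3]; split => //; lia.
(* Every cell reaches the right end of the top row [s] by steps to the right and, at the end of a
   row, up; each step lowers the measure. *)
have to_base m (c : 'I_(sumn g) * 'I_(sumn g)) : c.1 + (sumn g - c.2) < m ->
    in_skew l g (nat_of_ord c.1, nat_of_ord c.2) -> connect e c base.
  elim: m c => // m IHm [i j] /= lt_m c_in; move: (c_in).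
  rewrite /in_skew /in_diagram /= => c_in'.
  have /andP[le_si le_it] : s <= i <= t by rewrite -is_rim_row; lia.
  have [lt_j|ge_j] := ltnP j.+1 (nth 0 g i).
    have lt_jg : j.+1 < sumn g by apply: leq_trans lt_j (nth_leq_sumn _ _).
    apply: (@connect_trans _ _ (i, Ordinal lt_jg)).
      apply: connect1; apply/and3P; split => //; rewrite ?/in_skew ?/in_diagram /=.
        by lia.
      by rewrite !eqxx.
    by apply: IHm; rewrite /= ?/in_skew ?/in_diagram /=; have := ltn_ord j; lia.
  have [e_is|ne_is] := eqVneq (i : nat) s.
    have -> : (i, j) = base; last exact: connect0.
    by congr (_, _); apply: val_inj; rewrite /= -?e_is //; lia.
  have lt_i1 : i.-1 < sumn g by have := ltn_ord i; lia.
  (* So the last cell of row [i] lies just below the first skew cell of row [i.-1]. *)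
  have row_up : nth 0 g i = (nth 0 l i.-1).+1.
    by case: rim => _ _ inn _; rewrite -inn ?prednK //; lia.
  have := is_rim_row i.-1 => up_in.
  apply: (@connect_trans _ _ (Ordinal lt_i1, j)).
    apply: connect1; apply/and3P; split => //; rewrite ?/in_skew ?/in_diagram /=.
      by lia.
    by lia.
  by apply: IHm; rewrite /= ?/in_skew ?/in_diagram /=; lia.
apply/forallP => c; apply/forallP => d; apply/implyP => c_in; apply/implyP => d_in.
apply: connect_trans (to_base _ _ (ltnSn _) c_in) _.
by rewrite (sym_connect_sym e_sym) (to_base _ _ (ltnSn _)).
Qed.

End RimFacts.

Lemma covers_is_rim (l g : seq nat) : covers g l -> exists s, is_rim l g s s.
Proof.
case/andP => sub /eqP sumg; have [|s lt_s] := exists_grown_row sub; first by lia.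
exists s; split => // [i|i]; last by lia.
rewrite -neq_ltn => ne_is; apply/eqP; rewrite eqn_leq (subpart_nth i sub) andbT leqNgt.
apply/negP => lt_i; pose N := size l + size g.
have lt_N c : nth 0 l c < nth 0 g c -> c < N.
  move=> lt_c; rewrite ltnNge; apply/negP => le_c.
  by rewrite [nth 0 g c]nth_default ?(leq_trans (leq_addl _ _) le_c) in lt_c.
(* Two grown rows [s] and [i] would add at least two cells, against a total growth of one. *)
have := sumg; rewrite (sumn_nth_wide l g) (sumn_nth_wide g l) addnC -/N.
rewrite (bigD1 (Ordinal (lt_N s lt_s))) // (bigD1 (Ordinal (lt_N i lt_i))) //=.
rewrite [X in _ = X.+1](bigD1 (Ordinal (lt_N s lt_s))) //.
rewrite [X in _ = (_ + X).+1](bigD1 (Ordinal (lt_N i lt_i))) //=.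
set G := \sum_(_ < _ | _) _; set F := \sum_(_ < _ | _) _.
have : F <= G by apply: leq_sum => c _; apply: subpart_nth.
by lia.
Qed.

(** The equation [nth 0 g i.+1 = (nth 0 l i).+1] says that row [i.+1] of [g] has the beta number of
    row [i] of [l]. So the beta numbers of rows [s] to [t.-1] slide down one index, and only that of
    the top row is new. *)
Lemma is_rim_beta (k r s t : nat) (l g : seq nat) :
  sorted geq l -> sorted geq g -> size l <= r -> size g <= r ->
  sumn g = sumn l + k -> is_rim l g s t ->
  t < r /\ forall i, i < r ->
    beta r g i = move k (beta r l) (r - t.+1) (r - s.+1) i.
Proof.
move=> l_sorted g_sorted sl sg sumg rim.
have [le_st out inn top] := rim.
have lt_tr : t < r.
  rewrite ltnNge; apply/negP => le; have := is_rim_row l_sorted rim t.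
  by rewrite (nth_default _ (leq_trans sg le)); lia.
split => //.
have lt_jr : r - t.+1 < r by lia.
have lt_sr : r - s.+1 < r by lia.
have off i : i < r -> i != r - s.+1 ->
    beta r g i = move k (beta r l) (r - t.+1) (r - s.+1) i.
  move=> lt_ir ne_i; rewrite /move /beta (negPf ne_i).
  case: (ltnP i (r - t.+1)) => h1; first by rewrite out //; lia.
  case: (ltnP i (r - s.+1)) => h2; last by rewrite out //; lia.
  have := inn (r - i.+2) ltac:(lia).
  have -> : (r - i.+2).+1 = r - i.+1 by lia.
  by lia.
move=> i lt_ir; have [->|] := eqVneq i (r - s.+1); last exact: off.
(* The new entry equals [n j + k] because both sequences have the same total and agree everywhere
   else. *)
have := @sum_move k (beta r l) r (Ordinal lt_jr) (Ordinal lt_sr) ltac:(move=> /=; lia).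
have := sum_beta sg; rewrite sumg addnAC -sum_beta // => <- /=.
rewrite (bigD1 (Ordinal lt_sr)) //= [in X in _ = X](bigD1 (Ordinal lt_sr)) //=.
rewrite (eq_bigr (fun i : 'I_r => beta r g i)) => [|a ne_a].
  by move/eqP; rewrite eqn_add2r => /eqP.
by rewrite off // -val_eqE.
Qed.

Lemma beta_is_rim (k r : nat) (j s : 'I_r) (l g : seq nat) :
  sorted geq l -> sorted geq g -> size l <= r -> size g <= r -> 0 < k -> j <= s ->
  (forall i, i < r -> beta r g i = move k (beta r l) j s i) ->
  sumn g = sumn l + k /\ is_rim l g (r - s.+1) (r - j.+1).
Proof.
move=> l_sorted g_sorted sl sg k_gt0 le_js gE; split.
  have := @sum_move k (beta r l) r j s le_js.
  rewrite (eq_bigr (fun i : 'I_r => beta r g i)) => [|i _]; last by rewrite gE.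
  by rewrite !sum_beta //; lia.
have lt_sr := ltn_ord s; have lt_jr := ltn_ord j.
have row i : i < r -> beta r g (r - i.+1) = nth 0 g i + (r - i.+1)
    /\ beta r l (r - i.+1) = nth 0 l i + (r - i.+1).
  by move=> lt_ir; rewrite /beta; have -> : r - (r - i.+1).+1 = i by lia.
have gE' i (lt_ir : i < r) := gE (r - i.+1) ltac:(lia).
split.
- by lia.
- move=> i out; have [lt_ir|le_ri] := ltnP i r; last first.
    by rewrite !nth_default // (leq_trans _ le_ri).
  have := gE' i lt_ir; have [-> e] := row i lt_ir; rewrite /move e.
  by case: ifP => h1; first lia; case: ifP => h2; first lia; case: eqP => h3; lia.
- move=> i in_i; have := gE' i.+1 ltac:(lia); have [-> _] := row i.+1 ltac:(lia).
  have [_ e] := row i ltac:(lia).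
  rewrite /move ifF ?ifT; try lia.
  have -> : (r - i.+2).+1 = r - i.+1 by lia.
  by lia.
- have := gE s lt_sr; rewrite move_at //.
  have [<-|ne_js] := eqVneq (j : nat) s; first by rewrite /beta; lia.
  (* Below the moved entry, [g] has at index [s.-1] the beta number of [l] at [s]; strict increase
     then makes the top row grow. *)
  have := gE s.-1 ltac:(lia); rewrite /move ifF ?ifT; try lia.
  rewrite prednK; last by lia.
  have := @ltn_beta r g s.-1 s g_sorted ltac:(lia).
  by rewrite /beta; lia.
Qed.

End RimHooks.

(** * The Murnaghan-Nakayama rule *)

Section MurnaghanNakayama.

Variables (S : comNzRingType) (h p : nat -> S) (k : nat) (l : seq nat).
Hypothesis h0 : h 0%N = 1.
Hypothesis newton : forall m, (m <= k)%N ->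
  m%:R * h m = \sum_(i < m.+1) p i * h (m - i)%N.
Hypothesis k_gt0 : (0 < k)%N.
Hypothesis Hl : is_partition l.

(** The [k] empty rows make the first [k] beta numbers [0, ..., k - 1], as [power_sum_mul_jt_det]
    requires, and leave room for every rim hook of size [k]. *)
Let r := (size l + k)%N.
Let n := beta r l.
Let P := partitions_of (sumn l + k).
Let schur (g : seq nat) : S := jt_det h (size g) (beta (size g) g).
Let term (g : seq nat) : S := (-1) ^+ rim_height l g * schur g.

Let l_sorted : sorted geq l. Proof. by case/andP: Hl. Qed.

Let le_lr : (size l <= r)%N. Proof. exact: leq_addr. Qed.

Let n_incr (a b : nat) : (a < b)%N -> (n a < n b)%N.
Proof. exact: ltn_beta. Qed.

Let moves_to (j : 'I_r) (g : seq nat) : bool :=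
  (size g <= r)%N &&
  [exists s : 'I_r, (j <= s)%N && [forall i : 'I_r, beta r g i == move k n j s i]].

Let moves_toP (j : 'I_r) (g : seq nat) : moves_to j g -> (size g <= r)%N /\
  exists2 s : 'I_r, (j <= s)%N &
    forall i, (i < r)%N -> beta r g i = move k n j s i.
Proof.
case/andP => sg /existsP[s /andP[le_js /forallP gE]]; split => //.
by exists s => // i lt_ir; have /eqP := gE (Ordinal lt_ir).
Qed.

Let moves_toI (j s : 'I_r) (g : seq nat) : (size g <= r)%N -> (j <= s)%N ->
  (forall i, (i < r)%N -> beta r g i = move k n j s i) -> moves_to j g.
Proof.
move=> sg le_js gE; rewrite /moves_to sg; apply/existsP; exists s; rewrite le_js.
by apply/forallP => i; rewrite gE.
Qed.

Let moves_to_rim (j : 'I_r) (g : seq nat) :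
  is_partition g -> moves_to j g -> rim_hook k l g.
Proof.
move=> /andP[g_sorted _] /moves_toP[sg [s le_js gE]].
have [sumg rim] := beta_is_rim l_sorted g_sorted le_lr sg k_gt0 le_js gE.
apply/and4P; split.
- exact: is_rim_subpart rim.
- exact/eqP.
- exact: is_rim_connected rim g_sorted.
- exact: is_rim_no_square rim.
Qed.

Let rim_moves_to (g : seq nat) :
  is_partition g -> rim_hook k l g -> exists j, moves_to j g.
Proof.
move=> Pg g_rim; have /andP[g_sorted g_pos] := Pg; have /and4P[sub /eqP sumg _ _] := g_rim.
have sg : (size g <= r)%N.
  have [lt_lg|] := ltnP (size l) (size g); last by move/leq_trans; apply.
  (* Each row of [g] below the rows of [l] has a cell, so [g] has at most [k] new rows. *)
  have : (\sum_(i < size g) (nth 0 l i + (size l <= i)) <= sumn g)%N.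
    rewrite (@sumn_nth_ord g (size g)) => [|i le_gi]; last by rewrite nth_default.
    apply: leq_sum => i _; have [le_li|_] := leqP (size l) i.
      by rewrite nth_default //; apply: (all_nthP 0%N g_pos).
    by rewrite addn0 subpart_nth.
  rewrite big_split /= -sumn_nth_ord => [|i le_gi]; last first.
    by rewrite nth_default // (leq_trans (ltnW lt_lg)).
  rewrite sumg leq_add2l => le_k.
  have e : (\sum_(i < size g) (size l <= i : nat) = size g - size l)%N.
    transitivity (\sum_(i < size g | (size l <= i)%N) 1)%N.
      by rewrite [RHS]big_mkcond; apply: eq_bigr => i _; case: leqP.
    by rewrite -(big_geq_mkord _ _ xpredT (fun=> 1%N)) sum_nat_const_nat muln1.
  by rewrite /r -leq_subLR -e.
have [s [t rim]] := rim_hook_is_rim l_sorted g_sorted k_gt0 g_rim.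
have [lt_tr gE] := is_rim_beta l_sorted g_sorted le_lr sg sumg rim.
have le_st : (s <= t)%N by case: rim.
have lt_jr : (r - t.+1 < r)%N by lia.
have lt_sr : (r - s.+1 < r)%N by lia.
exists (Ordinal lt_jr); apply: (@moves_toI _ (Ordinal lt_sr)) => //=.
by lia.
Qed.

Let moves_to_inj (j j' : 'I_r) (g : seq nat) : moves_to j g -> moves_to j' g -> j = j'.
Proof.
move=> /moves_toP[_ [s le_js gE]] /moves_toP[_ [s' le_js' gE']]; apply: val_inj.
apply: (move_inj (k := k) (n := n) (r := r) (s := s) (s' := s')) => //.
by move=> i lt_ir; rewrite -gE // gE'.
Qed.

(** If [n j + k] is already a beta number, two columns agree and no partition is reached. Otherwise
    sorting yields the beta numbers of exactly one partition, with sign given by the height. *)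
Let jt_det_shift (j : 'I_r) :
  jt_det h r (fun i => if i == j :> nat then (n i + k)%N else n i)
    = \sum_(g <- P | moves_to j g) term g.
Proof.
have [/existsP[i /eqP n_i]|good] := boolP [exists i : 'I_r, n i == (n j + k)%N].
  have ne_ij : i != j by apply/eqP => e; move: n_i; rewrite e; lia.
  rewrite /jt_det (@det_eq_cols _ _ _ i j) // => [|a]; last first.
    by rewrite !mxE eqxx val_eqE (negPf ne_ij) n_i.
  rewrite big_seq_cond big1 // => g /andP[g_in /moves_toP[sg [s le_js gE]]].
  move: g_in; rewrite mem_partitions_of => /andP[/andP[g_sorted _] _].
  have g_incr a b := @ltn_beta r g a b g_sorted.
  have [_] := move_position k_gt0 n_incr g_incr le_js (ltn_ord s) gE (ltn_ord i).
  by rewrite n_i eqxx.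
(* The insertion position [s] is the last index whose entry is below [n j + k]. *)
have [s n_s s_max] := @arg_maxnP 'I_r j (fun i => n i < n j + k)%N (fun i => i) ltac:(lia).
have le_js : (j <= s)%N by apply: s_max; lia.
have n_above i : (s < i)%N -> (i < r)%N -> (n j + k < n i)%N.
  move=> lt_si lt_ir; rewrite ltn_neqAle; apply/andP; split.
    by apply/eqP => e; case/existsP: good; exists (Ordinal lt_ir); rewrite /= -e.
  by rewrite leqNgt; apply/negP => /(s_max (Ordinal lt_ir)) /=; lia.
have m_incr i : (i.+1 < r)%N -> (move k n j s i < move k n j s i.+1)%N.
  move=> lt_ir; have h1 := n_incr (ltnSn i); have h2 := n_incr (ltnSn i.+1).
  have h3 : (s < i.+1)%N -> (n j + k < n i.+1)%N by move=> lt; apply: n_above.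
  have h4 : (i.+1 == s)%N -> (n i.+1 < n j + k)%N by move/eqP->.
  have h5 : (i < j)%N -> (n i < n j)%N by apply: n_incr.
  by rewrite /move; do ![case: ifP => ?]; lia.
have [g [Pg sg gE]] := partition_of_beta m_incr.
have /andP[g_sorted _] := Pg.
have [sumg rim] := beta_is_rim l_sorted g_sorted le_lr sg k_gt0 le_js gE.
have g_in : g \in P by rewrite mem_partitions_of Pg sumg eqxx.
rewrite big_mkcond (bigD1_seq g) ?undup_uniq //= (moves_toI sg le_js gE).
rewrite big_seq_cond big1 ?addr0 => [|g' /andP[g'_in ne_g]]; last first.
  case: ifP => // /moves_toP[sg' [s' le_js' gE']]; case/eqP: ne_g.
  move: g'_in; rewrite mem_partitions_of => /andP[Pg' _].
  have /andP[g'_sorted _] := Pg'.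
  have g_incr a b := @ltn_beta r g a b g_sorted.
  have g'_incr a b := @ltn_beta r g' a b g'_sorted.
  have pos i lt_ir := move_position k_gt0 n_incr g_incr le_js (ltn_ord s) gE (i := i) lt_ir.
  have pos' i lt_ir := move_position k_gt0 n_incr g'_incr le_js' (ltn_ord s') gE' (i := i) lt_ir.
  (* [move_position] describes the insertion position through [n], [j] and [k] alone, so [g'] has
     the same beta numbers as [g]. *)
  have e : s = s'.
    have [e1 _] := pos s (ltn_ord s); have [e1' _] := pos' s (ltn_ord s).
    have [e2 _] := pos s' (ltn_ord s'); have [e2' _] := pos' s' (ltn_ord s').
    by apply: val_inj; apply/eqP; rewrite eqn_leq e2 -e2' e1' -e1 !leqnn.
  by apply: (beta_inj Pg' Pg sg' sg) => i lt_ir; rewrite gE' // gE // e.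
rewrite (jt_det_move h k n le_js) /term (is_rim_height l_sorted rim) /schur.
rewrite -(jt_det_pad h0 sg); congr (_ ^+ _ * _).
  by have := ltn_ord s; lia.
by rewrite /jt_det; congr (\det _); apply/matrixP => a b; rewrite !mxE gE.
Qed.

(** After exchanging the sums over [j] and [g], each rim hook is counted once: it comes from exactly
    one [j]. *)
Lemma murnaghan_nakayama :
  p k * jt_det h (size l) (beta (size l) l)
  = \sum_(g <- partitions_of (sumn l + k) | rim_hook k l g)
      (-1) ^+ rim_height l g * jt_det h (size g) (beta (size g) g).
Proof.
rewrite -(jt_det_pad h0 le_lr) (power_sum_mul_jt_det h0 newton k_gt0 (leq_addl _ _)); last first.
  by move=> j lt_jk; rewrite /beta nth_default // /r; lia.
rewrite (eq_bigr _ (fun j _ => jt_det_shift j)) [RHS]big_mkcond.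
under eq_bigr do rewrite big_mkcond.
rewrite exchange_big; apply: eq_big_seq => g; rewrite mem_partitions_of => /andP[Pg _].
case: ifP => [g_rim|g_nrim]; last first.
  by rewrite big1 // => j _; case: ifP => // /(moves_to_rim Pg); rewrite g_nrim.
have [j j_g] := rim_moves_to Pg g_rim.
rewrite (bigD1 j) //= j_g big1 ?addr0 // => j' ne_j.
by case: ifP => // /moves_to_inj /(_ j_g) /eqP; rewrite (negPf ne_j).
Qed.

End MurnaghanNakayama.

(** * From the Murnaghan-Nakayama rule back to the polynomials [Apart A l] *)

Lemma covers_rim_hook (l g : seq nat) : is_partition l -> is_partition g ->
  covers g l -> rim_hook 1 l g && (rim_height l g == 0%N).
Proof.
move=> /andP[l_sorted _] /andP[g_sorted _] cov; have [s rim] := covers_is_rim cov.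
rewrite (is_rim_height l_sorted rim) subnn eqxx andbT; case/andP: cov => sub /eqP sumg.
apply/and4P; split => //; first by rewrite sumg addn1.
- exact: is_rim_connected rim g_sorted.
- exact: is_rim_no_square rim.
Qed.

Theorem theorem6p2 (R : fieldType) (charR0 : [pchar R] =i pred0)
  (A : nat -> {poly R}) (HA : is_Appell A) (l : seq nat) (Hl : is_partition l) :
  ((sumn l).+1 * nSYT l)%:R *: (('X + (appell_c A 1)%:P) * Apart A l)
    = \sum_(g <- partitions_of (sumn l).+1 | covers g l) (nSYT g)%:R *: Apart A g
  /\
  (forall k : nat, (2 <= k)%N ->
     (k%:R * appell_c A k * ('C(sumn l + k, k) * nSYT l)%:R) *: Apart A l
       = \sum_(g <- partitions_of (sumn l + k) | rim_hook k l g)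
            ((-1) ^+ rim_height l g * (nSYT g)%:R) *: Apart A g).
Proof.
(* All [g] in the sum have size [sumn l + k], so one factor [(sumn l + k)!] turns every Jacobi-Trudi
   determinant into [F_g A_g]. *)
have mn k : (0 < k)%N ->
    ((sumn l + k)`!)%:R *: (appell_p A k k * jt_det (appell_h A) (size l) (beta (size l) l))
    = \sum_(g <- partitions_of (sumn l + k) | rim_hook k l g)
        ((-1) ^+ rim_height l g * (nSYT g)%:R) *: Apart A g.
  move=> k_gt0; rewrite (murnaghan_nakayama (appell_h0 HA)) //; last first.
    by move=> m le_mk; apply: newton_appell.
  rewrite scaler_sumr big_seq_cond [RHS]big_seq_cond; apply: eq_bigr => g.
  rewrite mem_partitions_of => /andP[/andP[Pg /eqP sg] _].
  rewrite -[RHS]scalerA nSYT_Apart // sg -mul_polyC -[RHS]mul_polyC -[in RHS]mul_polyC.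
  by rewrite rmorphXn /= polyCN polyC1 mulrCA.
split.
  have := mn 1%N isT; rewrite addn1 => mn1.
  (* Rim hooks of size 1 are the covers and have height 0, while [p_1 = x + c_1]. *)
  transitivity (\sum_(g <- partitions_of (sumn l).+1 | rim_hook 1 l g)
      ((-1) ^+ rim_height l g * (nSYT g)%:R) *: Apart A g); last first.
    rewrite big_seq_cond [RHS]big_seq_cond; apply: eq_big => g; last first.
      case/andP; rewrite mem_partitions_of => /andP[Pg _] /and4P[sub sg _ _].
      have cov : covers g l by rewrite /covers sub -addn1.
      by case/andP: (covers_rim_hook Hl Pg cov) => _ /eqP ->; rewrite mul1r.
    rewrite mem_partitions_of; apply: andb_id2l => /andP[Pg _].
    apply/idP/idP => [/and4P[sub sg _ _]|cov]; first by rewrite /covers sub -addn1.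
    by case/andP: (covers_rim_hook Hl Pg cov).
  rewrite -mn1 natrM -scalerA scalerAr nSYT_Apart // -scalerAr scalerA -natrM -factS.
  by rewrite /appell_p appell_cE !mul1r addrC.
move=> k k_ge2; rewrite -mn ?(ltn_trans _ k_ge2) // natrM mulrA -scalerA nSYT_Apart //.
rewrite scalerA /appell_p (gtn_eqF k_ge2) mul0r addr0 mul_polyC scalerA; congr (_ *: _).
(* Here [p_k = k c_k / k!], and [(sumn l + k)!] is the binomial times [k!] times [(sumn l)!], so the
   two [k!] cancel. *)
have := bin_fact (leq_addl (sumn l) k); rewrite addnK => <-.
by rewrite appell_cE !natrM; ring.
Qed.
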